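(* Let $\widehat\Gamma$ be a Harnack graph with controlled, uniformly lazy weights, $K$ a set of vertices, and suppose $\Gamma:=\widehat\Gamma\setminus K$ is an infinite inner uniform subgraph of $\widehat\Gamma$. For $x\in\Gamma$, $r>0$, let $B_{\partial_I}(x,r):=B_\Gamma(x,r)\cap\partial_I\Gamma$, $V_{\partial_I}(x,r):=\pi(B_{\partial_I}(x,r))$ and $W_{\partial_I}(x,r):=V_\Gamma(x,r)/V_{\partial_I}(x,r)$. Then: (1) If $\Gamma$ is uniformly $S$-transient, there exist $L',\varepsilon'>0$ such that $d(x,K)\ge L'$ implies $\sum_{n\ge d_\Gamma^2(x,\partial_I\Gamma)}\frac{1}{W_{\partial_I}(x,\sqrt n)}\le\varepsilon'$. (2) If for every $\varepsilon>0$ there is $L_\varepsilon>0$ such that $d(x,K)\ge L_\varepsilon$ implies $\sum_{n\ge d_\Gamma^2(x,\partial_I\Gamma)}\frac{1}{W_{\partial_I}(x,\sqrt n)}\le\varepsilon$, then $\Gamma$ is uniformly $S$-transient.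
   Context: $\widehat{\Gamma}$: infinite simple connected graph with symmetric edge weights $\mu_{xy}$ ($\neq0$ iff $x\sim y$) and vertex weights $\pi>0$, $\sum_{y\sim x}\mu_{xy}\le\pi(x)$; kernel $\mathcal{K}(x,y)=\mu_{xy}/\pi(x)$ ($x\ne y$), $\mathcal{K}(x,x)=1-\sum_{z\sim x}\mu_{xz}/\pi(x)$; controlled weights ($\mu_{xy}/\pi(x)\ge1/C_c$ for $y\sim x$), uniformly lazy ($\mathcal{K}(x,x)\ge C_e>0$). Harnack graph: $p(n,x,y)=\mathcal{K}^n(x,y)/\pi(y)$ satisfies $\frac{c_1}{V(x,\sqrt n)}e^{-d(x,y)^2/(c_2n)}\le p(n,x,y)\le\frac{c_3}{V(x,\sqrt n)}e^{-d(x,y)^2/(c_4 n)}$ for $n\ge d(x,y)$ ($d$ graph distance of $\widehat\Gamma$). $\Gamma$ is the induced subgraph on the complement of $K$, $d_\Gamma$ its intrinsic graph distance, $B_\Gamma(x,r)=\{y\in\Gamma:d_\Gamma(x,y)\le r\}$, $V_\Gamma(x,r)=\pi(B_\Gamma(x,r))$. $\partial\Gamma$: vertices outside $\Gamma$ adjacent to $\Gamma$; $\partial_I\Gamma$: vertices of $\Gamma$ adjacent to a vertex outside $\Gamma$. Inner uniform: $\exists c_u,C_U>0$ such that any $x,y\in\Gamma$ are joined by a path $x_0=x,\dots,x_k=y$ in $\Gamma$ with $k\le C_Ud_\Gamma(x,y)$ and $d(x_j,\partial\Gamma)\ge c_u(1+\min\{j,k-j\})$. $\psi_K(x)=\mathbb{P}^x(\tau_K<\infty)$;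 uniformly $S$-transient: $\exists L,\varepsilon>0$ with $\psi_K(x)\le1-\varepsilon$ whenever $d(x,K)\ge L$. If $V_{\partial_I}(x,r)=0$ then $1/W_{\partial_I}(x,r)=0$. *)

(* Defs.v *)
From HB Require Import structures.
From mathcomp Require Import all_boot all_order all_algebra.
From mathcomp Require Import all_classical all_reals all_analysis.
Set Implicit Arguments. Unset Strict Implicit. Unset Printing Implicit Defensive.
Import Order.TTheory GRing.Theory Num.Theory.
Local Open Scope classical_set_scope.
Local Open Scope ring_scope.

Section GraphDefs.
Variables (R : realType) (V : choiceType).
(* adj : adjacency of the graph \hat\Gamma ; mu : edge weights ; pi : vertex weights *)
Variables (adj : rel V) (mu : V -> V -> R) (pi : V -> R).

Definition walk_in (S : set V) (x y : V) (n : nat) : Prop :=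
  exists p : nat -> V, [/\ p 0%N = x, p n = y,
    (forall j, (j <= n)%N -> S (p j)) &
    (forall j, (j < n)%N -> adj (p j) (p j.+1))].

(* graph distance of the subgraph induced on S (+oo if not connected in S) *)
Definition dist_in (S : set V) (x y : V) : \bar R :=
  ereal_inf [set ((n%:R : R)%:E) | n in [set n | walk_in S x y n]].

Definition dist (x y : V) : \bar R := dist_in setT x y.

(* distance from a vertex to a set (+oo if the set is empty) *)
Definition dist_set (S : set V) (x : V) (A : set V) : \bar R :=
  ereal_inf [set dist_in S x y | y in A].

Definition pimeas (A : set V) : \bar R := \esum_(y in A) (pi y)%:E.

Definition ball (x : V) (r : R) : set V := [set y | (dist x y <= r%:E)%E].
Definition vol (x : V) (r : R) : R := fine (pimeas (ball x r)).

Definition kern (x y : V) : R :=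
  if x == y then 1 - fine (\esum_(z in [set z | adj x z]) (mu x z)%:E) / pi x
  else mu x y / pi x.

Fixpoint kpow (n : nat) (x y : V) : R :=
  match n with
  | 0%N => if x == y then 1 else 0
  | n'.+1 => fine (\esum_(z in [set: V]) (kern x z * kpow n' z y)%:E)
  end.

Definition hkern (n : nat) (x y : V) : R := kpow n x y / pi y.

Definition weights_ok : Prop :=
  [/\ (forall x, 0 < pi x),
      (forall x y, mu x y = mu y x),
      (forall x y, mu x y != 0 <-> adj x y) &
      (forall x, (\esum_(y in [set y | adj x y]) (mu x y)%:E <= (pi x)%:E)%E)].

Definition simple_connected_infinite : Prop :=
  [/\ (forall x y, adj x y = adj y x),
      (forall x, ~~ adj x x),
      (forall x y, exists n, walk_in setT x y n) &
      ~ finite_set [set: V]].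

Definition controlled_weights : Prop :=
  exists Cc : R, 0 < Cc /\ forall x y, adj x y -> Cc^-1 <= mu x y / pi x.

Definition uniformly_lazy : Prop :=
  exists Ce : R, 0 < Ce /\ forall x, Ce <= kern x x.

Definition harnack_graph : Prop :=
  exists c1 c2 c3 c4 : R, [/\ 0 < c1, 0 < c2, 0 < c3, 0 < c4 &
    forall (n : nat) (x y : V), (fine (dist x y) <= n%:R) ->
      c1 / vol x (Num.sqrt n%:R) * expR (- (fine (dist x y) ^+ 2) / (c2 * n%:R))
        <= hkern n x y /\
      hkern n x y <=
      c3 / vol x (Num.sqrt n%:R) * expR (- (fine (dist x y) ^+ 2) / (c4 * n%:R))].

Variable K : pred V.

Definition Gam : set V := [set x | ~~ K x].
Definition bdry : set V := [set y | K y /\ exists z, ~~ K z /\ adj y z].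
Definition bdryI : set V := [set y | ~~ K y /\ exists z, K z /\ adj y z].

Definition distG (x y : V) : \bar R := dist_in Gam x y.

Definition inner_uniform : Prop :=
  exists cu CU : R, [/\ 0 < cu, 0 < CU &
    forall x y, Gam x -> Gam y ->
      exists (k : nat) (p : nat -> V),
        [/\ p 0%N = x, p k = y,
            (forall j, (j <= k)%N -> Gam (p j)) /\
            (forall j, (j < k)%N -> adj (p j) (p j.+1)),
            ((k%:R)%:E <= CU%:E * distG x y)%E &
            (forall j, (j <= k)%N ->
               ((cu * (1 + (minn j (k - j))%:R))%:E <= dist_set setT (p j) bdry)%E)]].

(* P^x(tau_K <= n), via the Markov property *)
Fixpoint hitn (n : nat) (x : V) : R :=
  match n with
  | 0%N => if K x then 1 else 0
  | n'.+1 => if K x then 1 else fine (\esum_(z in [set: V]) (kern x z * hitn n' z)%:E)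
  end.

(* psi_K(x) = P^x(tau_K < oo) = sup_n P^x(tau_K <= n) *)
Definition psiK (x : V) : R := sup (range (fun n => hitn n x)).

Definition uniformly_S_transient : Prop :=
  exists L eps : R, [/\ 0 < L, 0 < eps &
    forall x, (L%:E <= dist_set setT x K)%E -> psiK x <= 1 - eps].

Definition ballG (x : V) (r : R) : set V := [set y | Gam y /\ (distG x y <= r%:E)%E].
Definition volG (x : V) (r : R) : R := fine (pimeas (ballG x r)).
Definition volI (x : V) (r : R) : R := fine (pimeas (ballG x r `&` bdryI)).
(* 1 / W_{\partial_I}(x,r) = V_{\partial_I}(x,r) / V_Gamma(x,r); equals 0 when V_{\partial_I} = 0 *)
Definition invW (x : V) (r : R) : R := volI x r / volG x r.

Definition bdry_series (x : V) : \bar R :=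
  \sum_(n <oo | (dist_set Gam x bdryI * dist_set Gam x bdryI <= (n%:R : R)%:E)%E)
     (invW x (Num.sqrt n%:R))%:E.

End GraphDefs.

(* Main.v *)
(** Part (1). Every visit to the inner boundary leads with probability bounded below, by inner
    uniformity and controlled weights, to a vertex at distance at least [L] from [K], from which
    [K] is avoided forever with probability at least [eps]; between two such attempts the walk
    makes boundedly many visits to the inner boundary before entering [K]. So the expected number
    of visits to the inner boundary by the walk on the whole graph is bounded, and the lower heat
    kernel bound, together with [V <= C V_Gamma] on inner balls, compares it with the series.

    Part (2). The hitting probability of [K] is at most the expected number of visits to the inner
    boundary, which the upper heat kernel bound controls by a series involving the distance [d]
    instead of [d_Gamma]. The two distances from [x] are comparable as soon as the series at [x]
    is small: otherwise [K] separates two large pieces of a ball around [x], the walk crosses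
    between them with probability bounded below, and so must meet many inner boundary vertices at
    inner distance of the order of the radius. That such vertices are not much further away in
    [d_Gamma] than in [d] is a packing argument with inner balls. *)
Require Import Defs.
From HB Require Import structures.
From mathcomp Require Import all_boot all_order all_algebra finmap.
From mathcomp Require Import all_classical all_reals all_analysis.
From mathcomp Require Import zify ring lra.
Import Order.TTheory GRing.Theory Num.Theory.
Local Open Scope classical_set_scope.
Local Open Scope ring_scope.
Set Implicit Arguments.
Unset Strict Implicit.
Unset Printing Implicit Defensive.

Section FiniteSums.
Variables (R : realType) (V : choiceType).
Implicit Types (A B : set V) (f g : V -> R).

Definition fsum A f : R := \sum_(y <- fset_set A) f y.

Lemma fsum_ext A f g : finite_set A -> (forall y, A y -> f y = g y) ->
  fsum A f = fsum A g.
Proof.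
move=> fA fg; rewrite /fsum big_seq [RHS]big_seq; apply: eq_bigr => y.
by rewrite in_fset_set// inE => /fg.
Qed.

Lemma fsum_le A f g : finite_set A -> (forall y, A y -> f y <= g y) ->
  fsum A f <= fsum A g.
Proof.
move=> fA fg; rewrite /fsum big_seq [leRHS]big_seq; apply: ler_sum => y.
by rewrite in_fset_set// inE => /fg.
Qed.

Lemma fsum_ge0 A f : finite_set A -> (forall y, A y -> 0 <= f y) -> 0 <= fsum A f.
Proof.
move=> fA fg; rewrite /fsum big_seq; apply: sumr_ge0 => y.
by rewrite in_fset_set// inE => /fg.
Qed.

Lemma fsum_mkcond A B f : finite_set B -> A `<=` B ->
  fsum A f = fsum B (fun y => if y \in A then f y else 0).
Proof.
move=> fB AB; have fA := sub_finite_set AB fB.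
rewrite /fsum -big_mkcond/= -[RHS]big_filter.
apply: perm_big; apply: uniq_perm.
- exact: fset_uniq.
- by apply: filter_uniq; exact: fset_uniq.
move=> y; rewrite mem_filter !in_fset_set//.
by apply/idP/andP => [yA|[]//]; split=> //; move: yA; rewrite !inE; exact: AB.
Qed.

Lemma fsum_sub A B f : finite_set B -> A `<=` B -> (forall y, B y -> 0 <= f y) ->
  fsum A f <= fsum B f.
Proof.
move=> fB AB f0; rewrite (@fsum_mkcond A B)//; apply: fsum_le => // y By.
by case: ifP => // _; exact: f0.
Qed.

Lemma fsum_eq0 A f : finite_set A -> (forall y, A y -> f y = 0) -> fsum A f = 0.
Proof. by move=> fA f0; rewrite (@fsum_ext A f (fun=> 0))// /fsum big1. Qed.

Lemma fsum1 A f x : finite_set A -> A x -> (forall y, A y -> y <> x -> f y = 0) ->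
  fsum A f = f x.
Proof.
move=> fA Ax f0; rewrite -[RHS](_ : fsum [set x] f = _).
  rewrite (@fsum_mkcond [set x] A)//; last by move=> y ->.
  apply: fsum_ext => // y Ay; case: ifPn => // /negP; rewrite inE /= => yx.
  by rewrite f0.
by rewrite /fsum fset_set1 big_seq_fset1.
Qed.

Lemma fsum_ge1 A f x : finite_set A -> A x -> (forall y, A y -> 0 <= f y) ->
  f x <= fsum A f.
Proof.
move=> fA Ax f0; rewrite -[f x](_ : fsum [set x] f = _).
  by apply: fsum_sub => // y ->.
by rewrite /fsum fset_set1 big_seq_fset1.
Qed.

Lemma fsumZ A c f : fsum A (fun y => c * f y) = c * fsum A f.
Proof. by rewrite /fsum mulr_sumr. Qed.

Lemma fsumZr A c f : fsum A (fun y => f y * c) = fsum A f * c.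
Proof. by rewrite /fsum mulr_suml. Qed.

Lemma fsumD A f g : fsum A (fun y => f y + g y) = fsum A f + fsum A g.
Proof. by rewrite /fsum big_split. Qed.

Lemma fsum_exchange A B (F : V -> V -> R) :
  fsum A (fun x => fsum B (F x)) = fsum B (fun y => fsum A (F^~ y)).
Proof. by rewrite /fsum exchange_big. Qed.

Lemma fsum_disjoint A B C f : finite_set C -> A `<=` C -> B `<=` C ->
    (forall y, A y -> B y -> False) -> (forall y, C y -> 0 <= f y) ->
  fsum A f + fsum B f <= fsum C f.
Proof.
move=> fC AC BC AB f0; rewrite (@fsum_mkcond A C)// (@fsum_mkcond B C)// -fsumD.
apply: fsum_le => // y Cy; case: ifPn => [|_].
  rewrite inE => yA; case: ifPn => [|_]; last by rewrite addr0.
  by rewrite inE => /(AB _ yA).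
by rewrite add0r; case: ifPn => // _; exact: f0.
Qed.

Lemma esum_fsum A f : finite_set A -> (forall y, A y -> 0 <= f y) ->
  (\esum_(y in A) (f y)%:E)%E = (fsum A f)%:E.
Proof.
move=> fA f0; rewrite esum_fset//; last by move=> y; rewrite inE => /f0; rewrite lee_fin.
by rewrite fsbig_finite//= sumEFin.
Qed.

Lemma esum_finsupp A f : finite_set A -> (forall y, 0 <= f y) ->
  (forall y, ~ A y -> f y = 0) -> (\esum_(y in [set: V]) (f y)%:E)%E = (fsum A f)%:E.
Proof.
move=> fA f0 fS; rewrite -esum_fsum// [in RHS]esum_mkcond.
apply: eq_esum => y _; case: ifPn => // /negP; rewrite inE => /fS ->//.
Qed.

End FiniteSums.

Section Walks.
Variables (V : choiceType) (adj : rel V).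
Hypothesis adjC : forall x y, adj x y = adj y x.
Implicit Types (S : set V) (x y z : V).

Local Notation walk := (walk_in adj).

Definition bal S x r : set V := [set y | exists m, (m <= r)%N /\ walk S x y m].

Lemma walk0 S x : S x -> walk S x x 0.
Proof. by move=> Sx; exists (fun=> x); split. Qed.

Lemma walk_adj S x y : S x -> S y -> adj x y -> walk S x y 1.
Proof.
move=> Sx Sy xy; exists (fun j => if j == 0%N then x else y); split=> //.
- by case=> [|[|]].
- by case.
Qed.

Lemma walk_cat S x y z m n : walk S x y m -> walk S y z n -> walk S x z (m + n).
Proof.
move=> [p [p0 pm pS pa]] [q [q0 qn qS qa]].
exists (fun j => if (j <= m)%N then p j else q (j - m)%N); split=> //.
- case: leqP => // h; last by rewrite addKn.
  have n0 : n = 0%N by lia.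
  by rewrite n0 addn0 pm -q0 -qn n0.
- move=> j jmn; case: leqP => h; first exact: pS.
  by apply: qS; lia.
- move=> j jmn; case: (ltngtP j m) => h.
  + exact: pa.
  + have -> : (j.+1 - m)%N = (j - m).+1 by lia.
    by apply: qa; lia.
  + by rewrite h subSnn pm -q0; apply: qa; lia.
Qed.

Lemma walk_rev S x y n : walk S x y n -> walk S y x n.
Proof.
move=> [p [p0 pn pS pa]]; exists (fun j => p (n - j)%N); split.
- by rewrite subn0.
- by rewrite subnn.
- by move=> j _; apply: pS; lia.
- move=> j jn; rewrite adjC; have -> : (n - j)%N = (n - j.+1).+1 by lia.
  apply: pa; lia.
Qed.

Lemma walk_sub S S' x y n : S `<=` S' -> walk S x y n -> walk S' x y n.
Proof. by move=> SS [p [p0 pn pS pa]]; exists p; split=> // j /pS/SS. Qed.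

Lemma walk_subT S x y n : walk S x y n -> walk setT x y n.
Proof. exact: walk_sub. Qed.

Lemma walk_endP S x y n : walk S x y n -> S y.
Proof. by move=> [p [_ <- pS _]]; exact: pS. Qed.

Lemma walk_prefix S (p : nat -> V) n i : (i <= n)%N ->
  (forall j, (j <= n)%N -> S (p j)) -> (forall j, (j < n)%N -> adj (p j) (p j.+1)) ->
  walk S (p 0%N) (p i) i.
Proof.
move=> iN pS pa; exists p; split=> // j ji; [apply: pS|apply: pa].
  exact: leq_trans ji iN.
exact: leq_trans ji iN.
Qed.

Lemma walk_inv0 S x y : walk S x y 0 -> x = y.
Proof. by move=> [p [<- <-]]. Qed.

Lemma walk_invS S x y n : walk S x y n.+1 -> exists z, [/\ S x, adj x z & walk S z y n].
Proof.
move=> [p [p0 pn pS pa]]; exists (p 1%N); split; [by rewrite -p0; exact: pS| |].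
  by rewrite -p0; exact: pa.
exists (fun j => p j.+1); split=> // j jn; [exact: pS|exact: pa].
Qed.

Lemma bal_refl S x r : S x -> bal S x r x.
Proof. by move=> Sx; exists 0%N; split=> //; exact: walk0. Qed.

Lemma bal_cat S x y z r s : bal S x r y -> bal S y s z -> bal S x (r + s) z.
Proof.
move=> [m [mr w]] [n [ns w']]; exists (m + n)%N; split; first exact: leq_add.
exact: walk_cat w w'.
Qed.

Lemma bal_sym S x y r : bal S x r y -> bal S y r x.
Proof. by move=> [m [mr w]]; exists m; split=> //; exact: walk_rev. Qed.

Lemma bal_le S x r s : (r <= s)%N -> bal S x r `<=` bal S x s.
Proof. by move=> rs y [m [mr w]]; exists m; split=> //; exact: leq_trans mr rs. Qed.

Lemma bal_subT S x r : bal S x r `<=` bal setT x r.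
Proof. by move=> y [m [mr /walk_subT w]]; exists m. Qed.

Lemma bal_adj S x y : S x -> S y -> adj x y -> bal S x 1 y.
Proof. by move=> Sx Sy xy; exists 1%N; split=> //; exact: walk_adj. Qed.

Lemma bal0 S x : S x -> bal S x 0 = [set x].
Proof.
move=> Sx; apply/seteqP; split => [y [m [+ w]]|y ->/=]; last exact: bal_refl.
by rewrite leqn0 => /eqP m0; move: w; rewrite m0 => /walk_inv0.
Qed.

Lemma balS S x r y : bal S x r.+1 y ->
  y = x \/ exists2 z, S x /\ adj x z & bal S z r y.
Proof.
move=> [[|m] [mr w]]; first by left; move: w => /walk_inv0.
by right; have [z [Sx xz w']] := walk_invS w; exists z => //; exists m.
Qed.

Lemma finite_bal S x r : (forall z, finite_set [set y | adj z y]) -> finite_set (bal S x r).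
Proof.
move=> fa; elim: r x => [|r IH] x.
  apply: (@sub_finite_set _ _ [set x]) => // y [m [+ w]].
  by rewrite leqn0 => /eqP m0; move: w; rewrite m0 => /walk_inv0.
apply: (@sub_finite_set _ _ ([set x] `|` \bigcup_(z in [set y | adj x y]) bal S z r)).
  move=> y /balS[->|[z [_ xz] zy]]; [by left|by right; exists z].
rewrite finite_setU; split=> //; apply: bigcup_finite => //.
Qed.

(* The distance in the subgraph induced on [S]; the junk value is 0 if there is no walk. *)
Definition gd S x y : nat :=
  xget 0%N [set m | walk S x y m /\ forall k, walk S x y k -> (m <= k)%N].

Lemma gdP S x y n : walk S x y n ->
  walk S x y (gd S x y) /\ forall k, walk S x y k -> (gd S x y <= k)%N.
Proof.
move=> w; have ex : exists m, `[< walk S x y m >] by exists n; apply/asboolP.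
have : [set m | walk S x y m /\ forall k, walk S x y k -> (m <= k)%N] (ex_minn ex).
  case: ex_minnP => m /asboolP wm mk; split=> // k wk; exact/mk/asboolP.
by move=> /(xgetI 0%N).
Qed.

Lemma gd_bal S x y n r : walk S x y n -> bal S x r y <-> (gd S x y <= r)%N.
Proof.
move=> /gdP[w wm]; split=> [[m [mr /wm]]|gr]; first by move=> h; exact: leq_trans h mr.
by exists (gd S x y).
Qed.

End Walks.

Section MarkovOperator.
Variables (R : realType) (V : choiceType) (adj : rel V) (mu : V -> V -> R) (pi : V -> R).
Variable Cc : R.
Hypothesis Hg : simple_connected_infinite adj.
Hypothesis Hw : weights_ok adj mu pi.
Hypothesis Cc_gt0 : 0 < Cc.
Hypothesis HCc : forall x y, adj x y -> Cc^-1 <= mu x y / pi x.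
Implicit Types (x y z : V) (f g : V -> R).

Local Notation kern := (kern adj mu pi).
Local Notation kpow := (kpow adj mu pi).
Local Notation walk := (walk_in adj).
Local Notation bal := (bal adj).

Lemma adjC x y : adj x y = adj y x. Proof. by case: Hg. Qed.
Lemma pi_gt0 x : 0 < pi x. Proof. by case: Hw. Qed.
Lemma pi_ge0 x : 0 <= pi x. Proof. exact/ltW/pi_gt0. Qed.
Lemma muC x y : mu x y = mu y x. Proof. by case: Hw. Qed.

Lemma mu_ge x y : adj x y -> Cc^-1 * pi x <= mu x y.
Proof. by move=> /HCc; rewrite ler_pdivlMr ?pi_gt0. Qed.

Lemma mu_eq0 x y : ~ adj x y -> mu x y = 0.
Proof. by case: Hw => _ _ h _ /h/negP; rewrite negbK => /eqP. Qed.

Lemma mu_ge0 x y : 0 <= mu x y.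
Proof.
case: (pselect (adj x y)) => [/mu_ge|/mu_eq0->//]; apply: le_trans.
by rewrite mulr_ge0 ?pi_ge0// invr_ge0 ltW.
Qed.

Lemma finite_adj x : finite_set [set y | adj x y].
Proof.
apply: contrapT => inf.
have [B BA cB] := infinite_set_fset (Num.truncn Cc).+1 inf.
have [_ _ _ /(_ x)] := Hw; apply/negP; rewrite -ltNge.
have := @esum_fsum R V [set` B] (mu x) (finite_fset B).
move=> /(_ (fun y _ => mu_ge0 x y)) e.
apply: (@lt_le_trans _ _ (\esum_(y in [set` B]) (mu x y)%:E)%E); last first.
  rewrite esum_mkcond [leRHS]esum_mkcond; apply: le_esum => y _.
  case: ifPn => [|_].
    by rewrite inE => /BA yA; rewrite mem_set.
  by case: ifPn => // _; rewrite lee_fin mu_ge0.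
rewrite e lte_fin; apply: (@lt_le_trans _ _ (fsum [set` B] (fun=> Cc^-1 * pi x))).
  rewrite /fsum set_fsetK big_const_seq count_predT iter_addr_0 -mulrnAl.
  rewrite -[ltLHS]mul1r ltr_pM2r ?pi_gt0// -mulr_natl ltr_pdivlMr// mul1r.
  by apply: (lt_le_trans (truncnS_gt Cc)); rewrite ler_nat.
by apply: fsum_le => [|y /BA /mu_ge//]; exact: finite_fset.
Qed.

Definition nb x : set V := [set y | y = x \/ adj x y].

Lemma finite_nb x : finite_set (nb x).
Proof.
have -> : nb x = [set x] `|` [set y | adj x y] by [].
by rewrite finite_setU; split=> //; exact: finite_adj.
Qed.

Lemma finite_ball S x r : finite_set (bal S x r).
Proof. exact/finite_bal/finite_adj. Qed.

Lemma kern_diag x : kern x x = 1 - fsum [set y | adj x y] (mu x) / pi x.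
Proof.
rewrite /Defs.kern eqxx esum_fsum//; last by move=> *; exact: mu_ge0.
exact: finite_adj.
Qed.

Lemma kern_off x y : x != y -> kern x y = mu x y / pi x.
Proof. by rewrite /Defs.kern => /negbTE ->. Qed.

Lemma kern_ge0 x y : 0 <= kern x y.
Proof.
have [<-|xy] := eqVneq x y; last first.
  by rewrite kern_off// divr_ge0 ?mu_ge0// pi_ge0.
rewrite kern_diag subr_ge0 ler_pdivrMr ?pi_gt0// mul1r.
have [_ _ _ /(_ x)] := Hw; rewrite esum_fsum//.
  exact: finite_adj.
by move=> *; exact: mu_ge0.
Qed.

Lemma adj_neq x y : adj x y -> x != y.
Proof. by apply: contraTneq => ->; case: Hg. Qed.

Lemma kern_adj x y : adj x y -> Cc^-1 <= kern x y.
Proof. by move=> xy; rewrite kern_off ?adj_neq//; exact: HCc. Qed.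

Lemma kern_out x y : ~ nb x y -> kern x y = 0.
Proof.
move=> nxy; rewrite kern_off; last by apply/eqP => xy; apply: nxy; left.
by rewrite mu_eq0 ?mul0r// => xy; apply: nxy; right.
Qed.

Lemma kern_sum x : fsum (nb x) (kern x) = 1.
Proof.
have nE : nb x = [set x] `|` [set y | adj x y] by [].
have e : fsum (nb x) (kern x) = kern x x + fsum [set y | adj x y] (kern x).
  rewrite (@fsum_mkcond _ _ [set y | adj x y] (nb x)); first last.
  - by move=> y; right.
  - exact: finite_nb.
  rewrite -[X in X + _](_ : fsum (nb x) (fun y => if y == x then kern x y else 0) = _).
    rewrite -fsumD; apply: fsum_ext; first exact: finite_nb.
    move=> y [->|xy]; first by rewrite eqxx ifN ?addr0// notin_setE/=; apply/negP; case: Hg.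
    by rewrite eq_sym (negbTE (adj_neq xy)) add0r mem_set.
  rewrite (@fsum1 _ _ _ _ x); [by rewrite eqxx|exact: finite_nb|by left|].
  by move=> y _ /eqP/negbTE ->.
rewrite e kern_diag -[RHS](subrK (fsum [set y | adj x y] (mu x) / pi x)); congr (_ + _).
rewrite -fsumZr; apply: fsum_ext; first exact: finite_adj.
by move=> y xy; rewrite kern_off// adj_neq.
Qed.

Lemma kern_sym x y : pi x * kern x y = pi y * kern y x.
Proof.
have [->//|xy] := eqVneq x y; rewrite !kern_off// 1?eq_sym// muC.
by rewrite mulrCA divff ?gt_eqF ?pi_gt0// mulrCA divff// gt_eqF ?pi_gt0.
Qed.

Definition Pop f x : R := fsum (nb x) (fun z => kern x z * f z).
Definition Pn n f : V -> R := iter n Pop f.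

Lemma Pop_le f g x : (forall z, nb x z -> f z <= g z) -> Pop f x <= Pop g x.
Proof.
move=> fg; apply: fsum_le; first exact: finite_nb.
by move=> z /fg; apply: ler_wpM2l; exact: kern_ge0.
Qed.

Lemma Pop_ext f g x : (forall z, nb x z -> f z = g z) -> Pop f x = Pop g x.
Proof.
move=> fg; apply: fsum_ext; first exact: finite_nb.
by move=> z /fg ->.
Qed.

Lemma Pop_cst c x : Pop (fun=> c) x = c.
Proof. by rewrite /Pop fsumZr kern_sum mul1r. Qed.

Lemma PopD f g x : Pop (fun z => f z + g z) x = Pop f x + Pop g x.
Proof.
rewrite /Pop -fsumD; apply: fsum_ext; first exact: finite_nb.
by move=> z _; rewrite mulrDr.
Qed.

Lemma PopZ c f x : Pop (fun z => c * f z) x = c * Pop f x.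
Proof.
rewrite /Pop -fsumZ; apply: fsum_ext; first exact: finite_nb.
by move=> z _; rewrite mulrCA.
Qed.

Lemma Pop_sum I (r : seq I) (F : I -> V -> R) x :
  Pop (fun z => \sum_(i <- r) F i z) x = \sum_(i <- r) Pop (F i) x.
Proof.
elim: r => [|i r IH].
  rewrite big_nil; under Pop_ext do rewrite big_nil.
  exact: Pop_cst.
by rewrite big_cons -IH -PopD; apply: Pop_ext => z _; rewrite big_cons.
Qed.

Lemma Pop_ge0 f x : (forall z, 0 <= f z) -> 0 <= Pop f x.
Proof. by move=> f0; rewrite -(Pop_cst 0 x); exact: Pop_le. Qed.

Lemma PnS n f x : Pn n.+1 f x = Pop (Pn n f) x. Proof. by []. Qed.

Lemma PnSr n f x : Pn n.+1 f x = Pn n (Pop f) x.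
Proof. by rewrite /Pn iterSr. Qed.

Lemma Pn_add m n f x : Pn (m + n) f x = Pn m (Pn n f) x.
Proof. by rewrite /Pn iterD. Qed.

Lemma nb_bal x z y n : nb x z -> bal setT z n y -> bal setT x n.+1 y.
Proof.
move=> [->|xz]; first exact: bal_le.
by rewrite -add1n; apply: bal_cat; exact: bal_adj.
Qed.

Lemma Pn_le n f g x : (forall y, bal setT x n y -> f y <= g y) -> Pn n f x <= Pn n g x.
Proof.
elim: n x => [|n IH] x fg; first by apply: fg; exact: bal_refl.
rewrite !PnS; apply: Pop_le => z xz; apply: IH => y /(nb_bal xz); exact: fg.
Qed.

Lemma Pn_ext n f g x : (forall y, bal setT x n y -> f y = g y) -> Pn n f x = Pn n g x.
Proof. by move=> fg; apply/eqP; rewrite eq_le !Pn_le// => y /fg ->. Qed.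

Lemma Pn_cst n c x : Pn n (fun=> c) x = c.
Proof.
elim: n x => // n IH x; rewrite PnS -[RHS](Pop_cst c x).
by apply: Pop_ext => z _; exact: IH.
Qed.

Lemma Pn_ge0 n f x : (forall z, 0 <= f z) -> 0 <= Pn n f x.
Proof. by move=> f0; rewrite -(Pn_cst n 0 x); exact: Pn_le. Qed.

Lemma Pn_le1 n f x : (forall z, f z <= 1) -> Pn n f x <= 1.
Proof. by move=> f0; rewrite -[leRHS](Pn_cst n 1 x); exact: Pn_le. Qed.

Lemma PnD n f g x : Pn n (fun z => f z + g z) x = Pn n f x + Pn n g x.
Proof.
elim: n x => // n IH x; rewrite !PnS -PopD; apply: Pop_ext => z _; exact: IH.
Qed.

Lemma PnZ n c f x : Pn n (fun z => c * f z) x = c * Pn n f x.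
Proof.
elim: n x => // n IH x; rewrite !PnS -PopZ; apply: Pop_ext => z _; exact: IH.
Qed.

Lemma Pn_sum n I (r : seq I) (F : I -> V -> R) x :
  Pn n (fun z => \sum_(i <- r) F i z) x = \sum_(i <- r) Pn n (F i) x.
Proof.
elim: n x => // n IH x; rewrite !PnS -Pop_sum; apply: Pop_ext => z _; exact: IH.
Qed.

Definition ind (A : set V) : V -> R := fun z => (z \in A)%:R.

Lemma ind_ge0 A z : 0 <= ind A z. Proof. exact: ler0n. Qed.
Lemma ind_le1 A z : ind A z <= 1. Proof. by rewrite /ind lern1 leq_b1. Qed.
Lemma indT A z : A z -> ind A z = 1. Proof. by rewrite /ind => /mem_set ->. Qed.
Lemma indF A z : ~ A z -> ind A z = 0. Proof. by move=> nA; rewrite /ind memNset. Qed.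

Lemma ind_le A B z : (A z -> B z) -> ind A z <= ind B z.
Proof.
move=> AB; case: (pselect (A z)) => Az; last by rewrite (indF Az) ind_ge0.
by rewrite !indT//; exact: AB.
Qed.

Lemma Pop_esum f x : (forall z, 0 <= f z) ->
  fine (\esum_(z in [set: V]) (kern x z * f z)%:E)%E = Pop f x.
Proof.
move=> f0; rewrite (@esum_finsupp _ _ (nb x))//; first exact: finite_nb.
  by move=> z; rewrite mulr_ge0// kern_ge0.
by move=> z /kern_out ->; rewrite mul0r.
Qed.

Lemma kpowE n x y : kpow n x y = Pn n (ind [set y]) x.
Proof.
elim: n x => [|n IH] x.
  rewrite /Pn/= /ind; case: eqVneq => [->|/eqP xy]; first by rewrite mem_set.
  by rewrite memNset.
rewrite PnS -Pop_esum; last by move=> z; apply: Pn_ge0; exact: ind_ge0.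
by rewrite [LHS]/=; under eq_esum do rewrite IH.
Qed.

Lemma kpow_ge0 n x y : 0 <= kpow n x y.
Proof. by rewrite kpowE; apply: Pn_ge0; exact: ind_ge0. Qed.

Lemma kpow_out n x y : ~ bal setT x n y -> kpow n x y = 0.
Proof.
move=> nxy; rewrite kpowE -(Pn_cst n 0 x); apply: Pn_ext => z xz.
by apply: indF => /= zy; apply: nxy; rewrite -zy.
Qed.

Lemma Pn_fsum n f x (A : set V) : finite_set A ->
    (forall y, bal setT x n y -> ~ A y -> f y = 0) ->
  Pn n f x = fsum A (fun y => kpow n x y * f y).
Proof.
move=> fA f0; transitivity (Pn n (fun z => \sum_(y <- fset_set A) f y * ind [set y] z) x).
  apply: Pn_ext => z xz; rewrite -/(fsum A _).
  case: (pselect (A z)) => Az; last first.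
    by rewrite fsum_eq0 ?f0// => y Ay; rewrite indF ?mulr0// => zy; apply: Az; rewrite zy.
  by rewrite (fsum1 fA Az) ?indT ?mulr1// => y _ yz; rewrite indF ?mulr0//= => /esym.
by rewrite Pn_sum; apply: eq_bigr => y _; rewrite PnZ kpowE mulrC.
Qed.

Lemma Pn_fsum_ge n f x (A : set V) : finite_set A -> (forall y, 0 <= f y) ->
  fsum A (fun y => kpow n x y * f y) <= Pn n f x.
Proof.
move=> fA f0; rewrite (@Pn_fsum n f x (A `|` bal setT x n)); first last.
- by move=> y xy h; exfalso; apply: h; right.
- by rewrite finite_setU; split=> //; exact: finite_ball.
apply: fsum_sub.
- by rewrite finite_setU; split=> //; exact: finite_ball.
- by move=> y; left.
- by move=> y _; rewrite mulr_ge0// kpow_ge0.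
Qed.

Lemma kpow_sum_le1 n x A : finite_set A -> fsum A (kpow n x) <= 1.
Proof.
move=> fA; rewrite -[leRHS](Pn_cst n 1 x); apply: le_trans (Pn_fsum_ge _ _ fA _) => //.
by apply: fsum_le => // y _; rewrite mulr1.
Qed.

Lemma kpow_sym n x y : pi x * kpow n x y = pi y * kpow n y x.
Proof.
elim: n x y => [|n IH] x y; first by rewrite /= eq_sym; case: eqP => [->//|]; rewrite !mulr0.
rewrite [in LHS]kpowE PnS /Pop -fsumZ.
have e z : pi x * (kern x z * Pn n (ind [set y]) z) = pi y * (kpow n y z * kern z x).
  by rewrite mulrA kern_sym -kpowE mulrAC IH; ring.
rewrite /fsum; under eq_bigr do rewrite e.
rewrite -mulr_sumr; congr (_ * _); rewrite kpowE PnSr (@Pn_fsum _ _ _ (nb x)).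
- apply: fsum_ext; first exact: finite_nb.
  move=> z _; congr (_ * _); rewrite /Pop; case: (pselect (nb z x)) => zx.
    rewrite (fsum1 (finite_nb z) zx) ?indT ?mulr1// => w _ wx.
    by rewrite indF ?mulr0//.
  rewrite kern_out// fsum_eq0// => [|w zw]; first exact: finite_nb.
  by rewrite indF ?mulr0//= => wx; apply: zx; rewrite -wx.
- exact: finite_nb.
- move=> z _ xz; apply: fsum_eq0 => [|w zw]; first exact: finite_nb.
  rewrite indF ?mulr0//= => wx; apply: xz; move: zw; rewrite wx => -[->|zx]; first by left.
  by right; rewrite adjC.
Qed.

Lemma pimeasE A : finite_set A -> fine (pimeas pi A) = fsum A pi.
Proof. by move=> fA; rewrite /pimeas esum_fsum// => y _; exact: pi_ge0. Qed.

Lemma Pn_pi_le n (A B : set V) : finite_set A -> finite_set B ->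
  fsum A (fun x => pi x * Pn n (ind B) x) <= fsum B pi.
Proof.
move=> fA fB.
rewrite (_ : fsum A _ = fsum A (fun x => fsum B (fun y => pi y * kpow n y x))); last first.
  apply: fsum_ext => // x _; rewrite (@Pn_fsum n (ind B) x B)//; last first.
    by move=> y _; exact: indF.
  rewrite -fsumZ; apply: fsum_ext => // y By; by rewrite indT// mulr1 kpow_sym.
rewrite fsum_exchange; apply: fsum_le => // y By.
by rewrite fsumZ ler_piMr ?pi_ge0// kpow_sum_le1.
Qed.

Variable K : pred V.
Local Notation hitn := (hitn adj mu pi K).

Lemma hitn_ge0_le1 n x : 0 <= hitn n x <= 1.
Proof.
elim: n x => [|n IH] x /=; case: (K x); rewrite ?lexx ?ler01//.
rewrite Pop_esum; last by move=> z; case/andP: (IH z).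
rewrite Pop_ge0/=; last by move=> z; case/andP: (IH z).
by rewrite -[leRHS](Pop_cst 1 x); apply: Pop_le => z _; case/andP: (IH z).
Qed.

Lemma hitnS n x : hitn n.+1 x = if K x then 1 else Pop (hitn n) x.
Proof.
rewrite /=; case: (K x) => //; rewrite Pop_esum// => z.
by case/andP: (hitn_ge0_le1 n z).
Qed.

Lemma hitnK n x : K x -> hitn n x = 1. Proof. by case: n => [|n] /= ->. Qed.

Lemma hitn_le_psiK n x : hitn n x <= psiK adj mu pi K x.
Proof.
apply: sup_upper_bound; last by exists n.
split; first by exists (hitn 0 x), 0%N.
by exists 1 => _ [m _ <-]; case/andP: (hitn_ge0_le1 m x).
Qed.

Lemma psiK_le x c : (forall n, hitn n x <= c) -> psiK adj mu pi K x <= c.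
Proof.
move=> h; apply: ge_sup; first by exists (hitn 0 x), 0%N.
by move=> _ [n _ <-].
Qed.


Variables c1 c2 c3 c4 Ce cu CU : R.
Hypotheses (c1_gt0 : 0 < c1) (c2_gt0 : 0 < c2) (c3_gt0 : 0 < c3) (c4_gt0 : 0 < c4).
Hypothesis HK : forall (n : nat) (x y : V), (fine (dist R adj x y) <= n%:R) ->
      c1 / vol adj pi x (Num.sqrt n%:R)
        * expR (- (fine (dist R adj x y) ^+ 2) / (c2 * n%:R))
        <= hkern adj mu pi n x y /\
      hkern adj mu pi n x y <=
      c3 / vol adj pi x (Num.sqrt n%:R)
        * expR (- (fine (dist R adj x y) ^+ 2) / (c4 * n%:R)).
Hypothesis Ce_gt0 : 0 < Ce.
Hypothesis HCe : forall x, Ce <= kern x x.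
Hypothesis cu_gt0 : 0 < cu.
Hypothesis Ginf : ~ finite_set (Gam K).
Hypothesis HIU : forall x y, Gam K x -> Gam K y ->
      exists (k : nat) (p : nat -> V),
        [/\ p 0%N = x, p k = y,
            (forall j, (j <= k)%N -> Gam K (p j)) /\
            (forall j, (j < k)%N -> adj (p j) (p j.+1)),
            ((k%:R)%:E <= CU%:E * distG R adj K x y)%E &
            (forall j, (j <= k)%N ->
               ((cu * (1 + (minn j (k - j))%:R))%:E
                  <= dist_set R adj setT (p j) (bdry adj K))%E)].

Lemma dist_in_walk S x y n : walk S x y n -> dist_in R adj S x y = ((gd adj S x y)%:R)%:E.
Proof.
move=> /gdP[w wm]; apply/eqP; rewrite eq_le; apply/andP; split.
  by apply: ereal_inf_lbound; exists (gd adj S x y).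
by apply: le_ereal_inf_tmp => _ [m /wm mw <-]; rewrite lee_fin ler_nat.
Qed.

Lemma dist_inP S x y (r : R) :
  (dist_in R adj S x y <= r%:E)%E <-> exists2 m, m%:R <= r & walk S x y m.
Proof.
split=> [|[m mr w]]; last first.
  by apply: (@le_trans _ _ (m%:R)%:E) => //; apply: ereal_inf_lbound; exists m.
case: (pselect (exists n, walk S x y n)) => [[n w]|nw].
  by rewrite (dist_in_walk w) lee_fin => ?; exists (gd adj S x y) => //; case: (gdP w).
rewrite /dist_in (_ : [set _ | _ in _] = set0); first by rewrite ereal_inf0.
by apply/seteqP; split=> // z [n w _]; exfalso; apply: nw; exists n.
Qed.

Lemma dist_setP S x A (c : R) :
  (c%:E <= dist_set R adj S x A)%E <->
  forall y m, A y -> walk S x y m -> c <= m%:R.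
Proof.
split=> [h y m Ay w|h].
  rewrite -lee_fin; apply: (le_trans h); apply: (@le_trans _ _ (dist_in R adj S x y)).
    by apply: ereal_inf_lbound; exists y.
  by apply: ereal_inf_lbound; exists m.
apply: le_ereal_inf_tmp => _ [y Ay <-]; apply: le_ereal_inf_tmp => _ [m w <-].
by rewrite lee_fin; exact: h w.
Qed.

Definition sq (n : nat) : nat := \max_(i < n.+1 | (i * i <= n)%N) i.

Lemma sqP m n : (m <= sq n)%N = (m * m <= n)%N.
Proof.
apply/idP/idP => [msq|mn].
  apply: (@leq_trans (sq n * sq n)); first exact: leq_mul.
  rewrite /sq; apply: (big_ind (fun i => (i * i <= n)%N)) => // a b.
  by rewrite /maxn; case: ltnP.
have mn1 : (m < n.+1)%N by nia.
exact: (@leq_bigmax_cond _ (fun i : 'I_n.+1 => (i * i <= n)%N) _ (Ordinal mn1)).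
Qed.

Lemma sq_sqrt m n : (m%:R <= Num.sqrt (n%:R : R)) = (m <= sq n)%N.
Proof.
rewrite sqP -(ler_nat R) natrM -expr2.
by rewrite -[in RHS](@sqr_sqrtr _ n%:R)// ler_pXn2r ?nnegrE ?sqrtr_ge0.
Qed.

Lemma sq_eq n r : (r * r <= n)%N -> (n < r.+1 * r.+1)%N -> sq n = r.
Proof.
move=> h1 h2; apply/eqP; rewrite eqn_leq sqP h1 andbT leqNgt.
by apply/negP; rewrite sqP => h; move: h2; rewrite ltnNge h.
Qed.

Lemma sq_lt n : (n < (sq n).+1 * (sq n).+1)%N.
Proof. by rewrite ltnNge -sqP ltnn. Qed.

Lemma sq_ge n : (sq n * sq n <= n)%N. Proof. by rewrite -sqP. Qed.

Lemma ball_sqrt x n : Defs.ball adj x (Num.sqrt (n%:R : R)) = bal setT x (sq n).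
Proof.
apply/seteqP; split=> y; rewrite /Defs.ball/=.
  by move=> /dist_inP[m mn w]; exists m; rewrite -sq_sqrt.
by move=> [m [mn w]]; apply/dist_inP; exists m => //; rewrite sq_sqrt.
Qed.

Lemma ballG_sqrt x n : ballG adj K x (Num.sqrt (n%:R : R)) = bal (Gam K) x (sq n).
Proof.
apply/seteqP; split=> y; rewrite /ballG/=.
  by move=> [_ /dist_inP[m mn w]]; exists m; rewrite -sq_sqrt.
move=> [m [mn w]]; split; first exact: walk_endP w.
by apply/dist_inP; exists m => //; rewrite sq_sqrt.
Qed.

Definition v x r := fsum (bal setT x r) pi.
Definition vG x r := fsum (bal (Gam K) x r) pi.
Definition vI x r := fsum (bal (Gam K) x r `&` bdryI adj K) pi.

Lemma vol_v x n : vol adj pi x (Num.sqrt n%:R) = v x (sq n).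
Proof. by rewrite /vol pimeasE ball_sqrt//; exact: finite_ball. Qed.

Lemma finite_ballI x r : finite_set (bal (Gam K) x r `&` bdryI adj K).
Proof. by apply: sub_finite_set (finite_ball (Gam K) x r); exact: subIsetl. Qed.

Lemma invW_v x n : invW adj pi K x (Num.sqrt n%:R) = vI x (sq n) / vG x (sq n).
Proof.
rewrite /invW /volI /volG !pimeasE ballG_sqrt//; first exact: finite_ball.
exact: finite_ballI.
Qed.

Lemma v_le x r s : (r <= s)%N -> v x r <= v x s.
Proof.
move=> rs; apply: fsum_sub; [exact: finite_ball|exact: bal_le|by move=> *; exact: pi_ge0].
Qed.

Lemma v0 x : v x 0 = pi x.
Proof. by rewrite /v bal0// /fsum fset_set1 big_seq_fset1. Qed.

Lemma v_ge_pi x r : pi x <= v x r.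
Proof. by rewrite -v0; exact: v_le. Qed.

Lemma v_gt0 x r : 0 < v x r.
Proof. exact: lt_le_trans (pi_gt0 x) (v_ge_pi x r). Qed.

Lemma vG_ge_pi x r : Gam K x -> pi x <= vG x r.
Proof.
move=> Gx; apply: fsum_ge1; [exact: finite_ball|exact: bal_refl|].
by move=> *; exact: pi_ge0.
Qed.

Lemma vG_gt0 x r : Gam K x -> 0 < vG x r.
Proof. by move=> /(vG_ge_pi r); apply: lt_le_trans; exact: pi_gt0. Qed.

Lemma vG_le_v x r : vG x r <= v x r.
Proof.
apply: fsum_sub; [exact: finite_ball|exact: bal_subT|by move=> *; exact: pi_ge0].
Qed.

Lemma vI_ge0 x r : 0 <= vI x r.
Proof. by apply: fsum_ge0 => [|*]; [exact: finite_ballI|exact: pi_ge0]. Qed.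

Lemma vI_le x r s : (r <= s)%N -> vI x r <= vI x s.
Proof.
move=> rs; apply: fsum_sub; [exact: finite_ballI| |by move=> *; exact: pi_ge0].
by move=> y [xy yI]; split=> //; exact: bal_le rs _ xy.
Qed.

Lemma v_shift x y s r : bal setT x s y -> v y r <= v x (s + r).
Proof.
move=> xy; apply: fsum_sub; [exact: finite_ball| |by move=> *; exact: pi_ge0].
by move=> z; exact: bal_cat.
Qed.

Lemma conn x y : exists n, walk setT x y n. Proof. by case: Hg. Qed.

Lemma dist_gd x y : fine (dist R adj x y) = (gd adj setT x y)%:R.
Proof. by have [n w] := conn x y; rewrite /dist (dist_in_walk w). Qed.

Lemma HK_lower n x y d : bal setT x d y -> (d <= n)%N ->
  c1 / v x (sq n) * expR (- (d%:R ^+ 2) / (c2 * n%:R)) * pi y <= kpow n x y.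
Proof.
move=> xy dn; have [k w] := conn x y.
have gdd : (gd adj setT x y <= d)%N by apply/(gd_bal _ w).
have [|+ _] := @HK n x y; first by rewrite dist_gd ler_nat (leq_trans gdd).
rewrite /hkern ler_pdivlMr ?pi_gt0// dist_gd vol_v; apply: le_trans.
rewrite ler_pM2r ?pi_gt0// ler_pM2l ?divr_gt0 ?v_gt0// ler_expR.
rewrite !mulNr lerN2 ler_wpM2r// ?invr_ge0 ?mulr_ge0 ?(ltW c2_gt0)//.
by rewrite ler_pXn2r ?nnegrE// ler_nat.
Qed.

Lemma HK_upper n x y d : (forall m, walk setT x y m -> (d <= m)%N) ->
  kpow n x y <= c3 / v x (sq n) * expR (- (d%:R ^+ 2) / (c4 * n%:R)) * pi y.
Proof.
move=> xy; have [k w] := conn x y; have [wg _] := gdP w.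
have dg := xy _ wg.
case: (leqP (gd adj setT x y) n) => gn; last first.
  rewrite kpow_out.
    by rewrite !mulr_ge0 ?invr_ge0 ?(ltW c3_gt0) ?expR_ge0 ?pi_ge0 ?(ltW (v_gt0 _ _)).
  by move=> /(gd_bal _ w); rewrite leqNgt gn.
have [|_] := @HK n x y; first by rewrite dist_gd ler_nat.
rewrite /hkern ler_pdivrMr ?pi_gt0// dist_gd vol_v => h; apply: (le_trans h).
rewrite ler_pM2r ?pi_gt0// ler_pM2l ?divr_gt0 ?v_gt0// ler_expR.
rewrite !mulNr lerN2 ler_wpM2r// ?invr_ge0 ?mulr_ge0 ?(ltW c4_gt0)//.
by rewrite ler_pXn2r ?nnegrE// ler_nat.
Qed.

Lemma v1_le x : v x 1 <= c3 / Ce * pi x.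
Proof.
have : Ce <= kpow 1 x x.
  apply: (le_trans (HCe x)); rewrite kpowE PnS /Pop.
  rewrite (fsum1 (finite_nb x) (or_introl erefl)) /Pn/=; first by rewrite indT ?mulr1.
  by move=> y _ yx; rewrite indF ?mulr0.
move=> /le_trans/(_ (@HK_upper 1 x x 0 _)) => /(_ (fun _ _ => isT)).
rewrite (@sq_eq 1 1)// expr0n/= oppr0 mul0r expR0 mulr1 => h.
rewrite mulrAC ler_pdivlMr// mulrC -ler_pdivlMr ?v_gt0//.
by rewrite mulrAC in h.
Qed.

Lemma bal_last x r z : bal setT x r.+1 z ->
  exists2 y, bal setT x r y & bal setT y 1 z.
Proof.
move=> /(bal_sym adjC)/balS[->|[y [_ zy] yx]].
  by exists z; exact: bal_refl.
exists y; first exact: (bal_sym adjC yx).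
by apply: (bal_sym adjC); exact: bal_adj.
Qed.

Lemma vS_le x r : v x r.+1 <= c3 / Ce * v x r.
Proof.
have fb := finite_ball setT.
rewrite /v -fsumZ; apply: (@le_trans _ _ (fsum (bal setT x r) (v^~ 1%N))); last first.
  by apply: fsum_le => // y _; exact: v1_le.
apply: (@le_trans _ _ (fsum (bal setT x r.+1)
    (fun z => fsum (bal setT x r) (fun y => if z \in bal setT y 1 then pi z else 0)))).
  apply: fsum_le => // z /bal_last[y xy yz].
  rewrite (le_trans _ (fsum_ge1 (fb x r) xy _)) ?mem_set// => w _.
  by case: ifP => // _; exact: pi_ge0.
rewrite fsum_exchange; apply: fsum_le => // y xy.
rewrite -fsum_mkcond//; first by move=> z yz; rewrite -addn1; exact: bal_cat yz.
Qed.

Lemma v_small x r : v x r <= (c3 / Ce) ^+ r * pi x.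
Proof.
elim: r => [|r IH]; first by rewrite v0 expr0 mul1r.
rewrite (le_trans (vS_le x r))// exprS -(mulrA (c3 / Ce)) ler_pM2l//.
by rewrite divr_gt0.
Qed.

Lemma doubling M : exists C, 0 < C /\ forall x r, v x (M * r.+1) <= C * v x r.
Proof.
pose q := c3 / Ce; have q_gt0 : 0 < q by rewrite divr_gt0.
pose e := expR (- (2 * (M%:R ^+ 2)) / c2); have e_gt0 : 0 < e by exact: expR_gt0.
exists (1 + q ^+ (M * M) + (c1 * e)^-1); split.
  by rewrite addr_gt0 ?invr_gt0 ?mulr_gt0// addr_gt0// exprn_gt0.
move=> x r; have vp := v_gt0 x r.
have qp : 0 < q ^+ (M * M) by rewrite exprn_gt0.
have cp : 0 < (c1 * e)^-1 by rewrite invr_gt0 mulr_gt0.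
case: M @e e_gt0 @q q_gt0 qp cp => [|M] e e_gt0 q q_gt0 qp cp.
  rewrite mul0n v0; apply: (le_trans (v_ge_pi x r)).
  by rewrite ler_peMl ?(ltW vp)// -addrA lerDl addr_ge0 ?(ltW qp) ?(ltW cp).
case: (ltnP r M.+1) => rM.
  apply: (@le_trans _ _ (q ^+ (M.+1 * M.+1) * v x r)); last first.
    by rewrite ler_pM2r// addrAC lerDr addr_ge0// ltW.
  apply: (@le_trans _ _ (v x (M.+1 * M.+1))); first by apply: v_le; rewrite leq_mul2l.
  apply: (le_trans (v_small x _)); rewrite ler_pM2l//; exact: v_ge_pi.
apply: (@le_trans _ _ ((c1 * e)^-1 * v x r)); last first.
  by rewrite ler_pM2r// lerDr addr_ge0// ltW.
rewrite mulrC ler_pdivlMr ?mulr_gt0//.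
pose n := (r * r.+1)%N; have sqn : sq n = r by apply: sq_eq; rewrite /n; clear; nia.
have h : fsum (bal setT x (M.+1 * r.+1)) (fun y => c1 / v x r * e * pi y) <=
         fsum (bal setT x (M.+1 * r.+1)) (kpow n x).
  apply: fsum_le => [|y xy]; first exact: finite_ball.
  apply: le_trans (HK_lower xy _); last by rewrite /n; move: rM; clear; nia.
  rewrite sqn ler_pM2r ?pi_gt0// ler_pM2l ?divr_gt0// ler_expR.
  rewrite !mulNr lerN2 invfM mulrA mulrAC ler_pM2r ?invr_gt0//.
  have r0 : (0 < r)%N by exact: leq_trans rM.
  rewrite ler_pdivrMr ?ltr0n ?muln_gt0 ?r0//.
  have rr : (r.+1%:R : R) <= 2 * r%:R by rewrite -natrM ler_nat; move: r0; clear; lia.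
  rewrite /n !natrM; move: rr (ler0n R r.+1); move: (r.+1%:R : R) (r%:R : R) (M.+1%:R : R).
  move=> s t m st s0; have -> : (m * s) ^+ 2 = m ^+ 2 * (s * s) by ring.
  have -> : 2 * m ^+ 2 * (t * s) = m ^+ 2 * (2 * t * s) by ring.
  by rewrite ler_wpM2l ?sqr_ge0// ler_wpM2r.
have := le_trans h (kpow_sum_le1 _ _ (finite_ball _ _ _)).
rewrite fsumZ -/(v x _) [c1 / _]mulrC -!mulrA mulrC ler_pdivrMr// mul1r => h'.
by rewrite mulrC -mulrA.
Qed.

Lemma bdry_first z w m : Gam K z -> K w -> walk setT z w m ->
  exists2 y, bdry adj K y & exists2 i, (i <= m)%N & walk setT z y i.
Proof.
move=> Gz Kw [p [p0 pm pS pa]].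
have ex : exists i, K (p i) by exists m; rewrite pm.
case: (ex_minnP ex) => i Ki imin; have im : (i <= m)%N by apply: imin; rewrite pm.
case: i Ki imin im => [|i] Ki imin im; first by move: Gz; rewrite /Gam/= -p0 Ki.
exists (p i.+1); last by exists i.+1 => //; rewrite -p0; exact: (walk_prefix im).
split=> //; exists (p i); split; last by rewrite adjC; exact: pa.
by apply/negP => /imin; rewrite ltnn.
Qed.

Lemma bdry_far_bal z (c : R) a : Gam K z ->
  (c%:E <= dist_set R adj setT z (bdry adj K))%E -> a%:R < c ->
  bal setT z a `<=` bal (Gam K) z a.
Proof.
move=> Gz /dist_setP h ac y [m [ma [p [p0 pm pS pa]]]].
exists m; split=> //; exists p; split=> // j jm; apply/negP => Kj.
have [|w bw [i ij zw]] := @bdry_first z (p j) j Gz Kj.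
  by rewrite -p0; exact: (walk_prefix jm).
have := h _ _ bw zw; apply/negP; rewrite -ltNge; apply: le_lt_trans ac.
by rewrite ler_nat (leq_trans ij)// (leq_trans jm).
Qed.

Lemma bdry_far_K z (c : R) : Gam K z ->
  (c%:E <= dist_set R adj setT z (bdry adj K))%E -> (c%:E <= dist_set R adj setT z K)%E.
Proof.
move=> Gz /dist_setP h; apply/dist_setP => y m Ky w.
have [u bu [i im zu]] := bdry_first Gz Ky w.
by apply: (le_trans (h _ _ bu zu)); rewrite ler_nat.
Qed.

Lemma inner_point x j : Gam K x -> exists2 z, walk (Gam K) x z j &
  ((cu * (1 + j%:R))%:E <= dist_set R adj setT z (bdry adj K))%E.
Proof.
move=> Gx; have [y [Gy nxy]] : exists y, Gam K y /\ ~ bal (Gam K) x (j + j) y.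
  apply: contrapT => nex; apply: Ginf.
  apply: (sub_finite_set _ (finite_ball (Gam K) x (j + j))) => y Gy.
  by apply: contrapT => nxy; apply: nex; exists y.
have [k [p [p0 pk [pG pa] _ pd]]] := HIU Gx Gy.
have jk : (j + j < k)%N.
  rewrite ltnNge; apply/negP => kj; apply: nxy; exists k; split=> //.
  by exists p; split.
have jk' : (j <= k)%N by lia.
exists (p j); first by rewrite -p0; exact: (walk_prefix jk').
by have := pd j jk'; rewrite (_ : minn _ _ = j)//; lia.
Qed.

Lemma vG_large : exists C, 0 < C /\ forall x r, Gam K x -> v x r <= C * vG x r.
Proof.
pose M := (Num.truncn cu^-1).+1.
have Mcu : M%:R^-1 < cu.
  by rewrite invf_plt ?posrE// truncnS_gt.
have [C [C_gt0 HC]] := doubling (3 * M).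
exists C; split=> // x r Gx.
pose j := r./2; pose a := (j %/ M)%N.
have [z xz zd] := inner_point j Gx.
have rj : (r <= j.*2.+1)%N by rewrite /j; clear; lia.
have jr : (j.*2 <= r)%N by rewrite /j; clear; lia.
have ja : (j < a.+1 * M)%N by rewrite /a; exact: ltn_ceil.
have aj : (a <= j)%N by exact: leq_div.
apply: (@le_trans _ _ (v z (j + r))).
  apply: v_shift; exists j; split=> //; exact: (walk_rev adjC (walk_subT xz)).
apply: (@le_trans _ _ (v z (3 * M * a.+1))); first by apply: v_le; move: rj ja; clear; nia.
apply: (le_trans (HC z a)); rewrite ler_pM2l//.
apply: fsum_sub; [exact: finite_ball| |by move=> *; exact: pi_ge0].
move=> y /(bdry_far_bal (walk_endP xz) zd) zy.
have ac : a%:R < cu * (1 + j%:R).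
  have : (a * M <= j)%N by exact: leq_divM.
  rewrite -(ler_nat R) natrM -ler_pdivlMr ?ltr0n// => /le_lt_trans; apply.
  apply: (@le_lt_trans _ _ (j%:R * cu)); first by rewrite ler_wpM2l// ltW.
  by rewrite mulrC ltr_pM2l// ltrDr.
have := bal_cat (ex_intro _ j (conj (leqnn _) xz)) (zy ac); apply: bal_le.
by move: aj jr; clear; lia.
Qed.

Local Notation dI := (bdryI adj K).

(* The expected number of visits to the inner boundary before time [N]. *)
Definition green N x : R := \sum_(n < N) Pn n (ind dI) x.

Lemma green0 x : green 0 x = 0. Proof. by rewrite /green big_ord0. Qed.

Lemma greenS N x : green N.+1 x = ind dI x + Pop (green N) x.
Proof. by rewrite /green big_ord_recl Pop_sum. Qed.

Lemma green_add m N x : green (m + N) x = green m x + Pn m (green N) x.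
Proof.
rewrite /green big_split_ord/= Pn_sum; congr (_ + _).
by apply: eq_bigr => i _; rewrite -Pn_add.
Qed.

Lemma green_le N x : green N x <= N%:R.
Proof.
rewrite /green; apply: (@le_trans _ _ (\sum_(n < N) 1)).
  by apply: ler_sum => n _; apply: Pn_le1; exact: ind_le1.
by rewrite sumr_const card_ord.
Qed.

Lemma kpow_walk x y n : walk setT x y n -> Cc^-1 ^+ n <= kpow n x y.
Proof.
elim: n x => [|n IH] x.
  by move=> /walk_inv0 ->; rewrite /= eqxx.
move=> /walk_invS[z [_ xz /IH zy]].
rewrite kpowE PnS /Pop; apply: le_trans (fsum_ge1 (finite_nb x) (or_intror xz) _).
  rewrite -kpowE exprS ler_pM ?exprn_ge0 ?invr_ge0 ?(ltW Cc_gt0)//; exact: kern_adj.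
by move=> w _; rewrite mulr_ge0 ?kern_ge0// Pn_ge0//; exact: ind_ge0.
Qed.

Lemma bdryI_exit x : ind dI x <= Cc * Pop (fun z => (K z)%:R) x.
Proof.
have P0 : 0 <= Pop (fun z => (K z)%:R) x by apply: Pop_ge0 => z; rewrite ler0n.
case: (pselect (dI x)) => [[Gx [z [Kz xz]]]|nx]; last first.
  by rewrite indF// mulr_ge0// ltW.
apply: (le_trans (ind_le1 _ _)); rewrite mulrC -ler_pdivrMr// mul1r.
apply: (le_trans (kern_adj xz)); rewrite /Pop.
apply: le_trans (fsum_ge1 (finite_nb x) (or_intror xz) _).
  by rewrite Kz mulr1.
by move=> w _; rewrite mulr_ge0 ?kern_ge0.
Qed.

(* Each visit to the inner boundary enters [K] with probability at least [1/Cc], so before the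
   hitting time of [K] there are at most [Cc] expected visits, and after it at most [B]. *)
Lemma green_hit N B : 0 <= B -> (forall M x, (M <= N)%N -> green M x <= B) ->
  forall M x, (M <= N)%N -> green M x <= (Cc + B) * hitn M x - Cc * (K x)%:R.
Proof.
move=> B0 HB; elim=> [|M IH] x MN.
  case: (boolP (K x)) => Kx; first by rewrite hitnK// mulr1 mulr1 addrAC subrr add0r; exact: HB.
  by rewrite green0 /= (negbTE Kx) !mulr0 subrr.
case: (boolP (K x)) => Kx.
  by rewrite hitnK// mulr1 mulr1 addrAC subrr add0r; exact: HB.
rewrite greenS hitnS (negbTE Kx) mulr0 subr0.
have h : Pop (green M) x <=
    Pop (fun z => (Cc + B) * hitn M z + (- Cc) * (K z)%:R) x.
  by apply: Pop_le => z _; rewrite mulNr; apply: IH; exact: ltnW.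
rewrite PopD !PopZ in h; have := bdryI_exit x; lra.
Qed.

Lemma green_bounded : uniformly_S_transient adj mu pi K ->
  exists B, 0 < B /\ forall N x, green N x <= B.
Proof.
move=> [L [eps [L_gt0 eps_gt0 HL]]].
pose j := (Num.truncn (L / cu)).+1.
have jL : L <= cu * (1 + j%:R).
  rewrite mulrC -ler_pdivrMr//; apply: (le_trans (ltW (truncnS_gt _))).
  by rewrite -/j lerDr.
pose delta := Cc^-1 ^+ j; have delta_gt0 : 0 < delta by rewrite exprn_gt0// invr_gt0.
pose B := (j%:R / delta + Cc) / eps + j%:R.
have j0 : 0 <= (j%:R : R) by [].
have jd0 : 0 <= j%:R / delta by rewrite divr_ge0// ltW.
have B_gt0 : 0 < B by rewrite ltr_wpDr// divr_gt0// ltr_wpDl.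
exists B; split=> //.
suff H : forall N M x, (M <= N)%N -> green M x <= B by move=> N x; exact: H (leqnn N).
elim=> [|N IH] M x; first by rewrite leqn0 => /eqP ->; rewrite green0 ltW.
rewrite leq_eqVlt ltnS => /orP[/eqP->|]; last exact: IH.
case: (pselect (dI x)) => [Ix|nI]; last first.
  rewrite greenS indF// add0r -[leRHS](Pop_cst B x); apply: Pop_le => z _; exact: IH.
have Bj : j%:R <= B by rewrite lerDr divr_ge0 ?(ltW eps_gt0)// addr_ge0// ltW.
case: (leqP N.+1 j) => Nj.
  by apply: (le_trans (green_le _ _)); apply: le_trans Bj; rewrite ler_nat.
have [z xz zd] := @inner_point x j (proj1 Ix).
have zG := walk_endP xz.
have hz M' : hitn M' z <= 1 - eps.
  apply: (le_trans (hitn_le_psiK _ _)); apply: HL.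
  by apply: (bdry_far_K zG); apply: le_trans zd; rewrite lee_fin.
pose N' := (N.+1 - j)%N; have N'N : (N' <= N)%N by rewrite /N' /j subSS leq_subr.
have gz : green N' z - B <= - (j%:R / delta).
  have gh := green_hit (ltW B_gt0) IH z N'N.
  rewrite (negbTE zG) mulr0 subr0 in gh.
  have CB : 0 < Cc + B by rewrite addr_gt0.
  have h1 := ler_wpM2l (ltW CB) (hz N').
  have e1 : eps * B = j%:R / delta + Cc + eps * j%:R.
    by rewrite /B mulrDr mulrCA divff ?mulr1// gt_eqF.
  have e2 : 0 <= eps * j%:R by rewrite mulr_ge0// ltW.
  have e3 : 0 <= Cc * eps by rewrite mulr_ge0// ltW.
  have e4 : (Cc + B) * (1 - eps) = Cc + B - Cc * eps - eps * B by ring.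
  rewrite e4 e1 in h1; lra.
have -> : N.+1 = (j + N')%N by rewrite /N' subnKC// ltnW.
rewrite green_add; have gj := green_le j x.
have : Pn j (green N') x <= Pn j (fun w => B + (green N' z - B) * ind [set z] w) x.
  apply: Pn_le => w _; case: (eqVneq w z) => [->|/eqP wz].
    by rewrite indT// mulr1 addrC subrK.
  by rewrite indF// mulr0 addr0; exact: IH.
rewrite PnD PnZ Pn_cst -kpowE => h.
have kz := kpow_walk (walk_subT xz).
have : (green N' z - B) * kpow j x z <= - (j%:R / delta) * delta.
  apply: (@le_trans _ _ (- (j%:R / delta) * kpow j x z)).
    by rewrite ler_wpM2r// kpow_ge0.
  by rewrite !mulNr lerN2 ler_wpM2l.
by rewrite mulNr divfK ?gt_eqF//; lra.
Qed.

Lemma vI_green n x : expR (- c2^-1) * c1 * (vI x (sq n) / v x (sq n)) <= Pn n (ind dI) x.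
Proof.
have fin := finite_ballI x (sq n).
apply: le_trans (Pn_fsum_ge n x fin (ind_ge0 _)).
have -> : expR (- c2^-1) * c1 * (vI x (sq n) / v x (sq n)) =
  c1 / v x (sq n) * expR (- c2^-1) * vI x (sq n) by ring.
rewrite /vI -fsumZ; apply: fsum_le => // y [xy Iy].
have sn : (sq n <= n)%N by apply: leq_trans (sq_ge n); case: (sq n) => // k; rewrite leq_pmulr.
rewrite indT// mulr1; apply: le_trans (HK_lower (bal_subT xy) sn).
rewrite ler_pM2r ?pi_gt0// ler_pM2l ?divr_gt0 ?v_gt0// ler_expR mulNr lerN2.
rewrite invfM mulrCA ler_piMr ?invr_ge0 ?(ltW c2_gt0)//.
have := sq_ge n; rewrite -(ler_nat R) natrM -expr2.
case: n {fin sn xy} => [|n] h; first by rewrite invr0 mulr0.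
by rewrite ler_pdivrMr ?ltr0n// mul1r.
Qed.

Lemma invW_ge0 x n : Gam K x -> 0 <= invW adj pi K x (Num.sqrt n%:R).
Proof. by move=> Gx; rewrite invW_v divr_ge0 ?vI_ge0// ltW// vG_gt0. Qed.

Lemma bdry_series_le x (c : R) : Gam K x ->
  (forall N, \sum_(n < N) invW adj pi K x (Num.sqrt n%:R) <= c) ->
  (bdry_series adj pi K x <= c%:E)%E.
Proof.
move=> Gx h; rewrite /bdry_series; apply: lime_le.
  by apply: is_cvg_nneseries => n _ _; rewrite lee_fin invW_ge0.
apply: nearW => N; apply: (@le_trans _ _ (\sum_(n < N) (invW adj pi K x (Num.sqrt n%:R))%:E)%E).
  rewrite big_mkord [leLHS]big_mkcond; apply: lee_sum => n _.
  by case: ifP => // _; rewrite lee_fin invW_ge0.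
by rewrite sumEFin lee_fin.
Qed.

Lemma dist_set_le_walk S x A y m : A y -> walk S x y m ->
  (dist_set R adj S x A <= (m%:R)%:E)%E.
Proof.
move=> Ay w; apply: (@le_trans _ _ (dist_in R adj S x y)).
  by apply: ereal_inf_lbound; exists y.
by apply: ereal_inf_lbound; exists m.
Qed.

Lemma dist_set_ge0 S x A : (0 <= dist_set R adj S x A)%E.
Proof. by apply/dist_setP => y m _ _. Qed.

(* The restriction on [n] in [bdry_series] only drops terms in which [vI] vanishes. *)
Lemma bdry_series_ge x N : Gam K x ->
  ((\sum_(n < N) invW adj pi K x (Num.sqrt n%:R))%:E <= bdry_series adj pi K x)%E.
Proof.
move=> Gx; rewrite /bdry_series.
apply: (@le_trans _ _ (\sum_(0 <= n < N | (dist_set R adj (Gam K) x dI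
   * dist_set R adj (Gam K) x dI <= (n%:R)%:E)%E) (invW adj pi K x (Num.sqrt n%:R))%:E)%E).
  rewrite big_mkord [leRHS]big_mkcond -sumEFin; apply: lee_sum => n _.
  case: ifPn => // /negP nd; rewrite lee_fin invW_v /vI.
  rewrite fsum_eq0 ?mul0r//; first exact: finite_ballI.
  move=> y [[m [mn w]] Iy]; exfalso; apply: nd.
  have h := dist_set_le_walk Iy w.
  apply: (@le_trans _ _ ((m%:R)%:E * (m%:R)%:E)%E).
    by apply: lee_pmul => //; exact: dist_set_ge0.
  by rewrite -EFinM lee_fin -natrM ler_nat -sqP.
by apply: nneseries_lim_ge => n _ _; rewrite lee_fin invW_ge0.
Qed.

Lemma transient_series : uniformly_S_transient adj mu pi K ->
  exists L' eps' : R, [/\ 0 < L', 0 < eps' &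
       forall x, Gam K x -> (L'%:E <= dist_set R adj setT x K)%E ->
         (bdry_series adj pi K x <= eps'%:E)%E].
Proof.
move=> /green_bounded[B [B_gt0 HB]]; have [C [C_gt0 HC]] := vG_large.
pose e := expR (- c2^-1) * c1; have e_gt0 : 0 < e by rewrite mulr_gt0// expR_gt0.
exists 1, (C / e * B); split; rewrite ?mulr_gt0 ?invr_gt0// => x Gx _.
apply: bdry_series_le => // N; apply: (@le_trans _ _ (C / e * green N x)); last first.
  by rewrite ler_pM2l ?divr_gt0.
rewrite mulr_sumr; apply: ler_sum => n _.
rewrite invW_v; apply: (@le_trans _ _ (C * (vI x (sq n) / v x (sq n)))).
  rewrite mulrCA ler_wpM2l ?vI_ge0// ler_pdivlMr ?v_gt0// mulrC ler_pdivrMr ?vG_gt0//.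
  exact: HC.
rewrite -(mulrA C) ler_pM2l// (mulrC e^-1) ler_pdivlMr// mulrC; exact: vI_green.
Qed.

(* Disjoint inner balls around points of the walk at inner distances [3 s k] from [x] fill the
   ball of radius [2 s], so there are boundedly many of them. *)
Lemma inner_diameter : exists N, (0 < N)%N /\ forall x s y m, (0 < s)%N ->
  walk (Gam K `&` bal setT x s) x y m -> bal (Gam K) x (N * s) y.
Proof.
have [C1 [C1_gt0 HC1]] := vG_large; have [C2 [C2_gt0 HC2]] := doubling 3.
pose C := C2 * C1; have C_gt0 : 0 < C by rewrite mulr_gt0.
pose N0 := (Num.truncn C).+1.
exists (3 * N0)%N; split=> // x s y m s0 [p [p0 pm pS pa]].
apply: contrapT => nxy.
have Gx : Gam K x by have [] := pS 0%N isT; rewrite p0.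
have vq q : Gam K q -> bal setT x s q -> v x (s + s) <= C * vG q s.
  move=> Gq /(bal_sym adjC) /v_shift -/(_ (s + s)%N) h; apply: (le_trans h).
  apply: (@le_trans _ _ (v q (3 * s.+1))); first by apply: v_le; clear; lia.
  by apply: (le_trans (HC2 q s)); rewrite /C -mulrA ler_pM2l//; exact: HC1.
pose E k := bal setT x (s + s) `&` bal (Gam K) x (3 * s * k + s).
have fE k : finite_set (E k).
  by apply: sub_finite_set (finite_ball setT x (s + s)); exact: subIsetl.
have HE k : (k <= N0)%N -> k%:R * v x (s + s) <= C * fsum (E k) pi.
  elim: k => [|k IH] kN.
    rewrite mul0r mulr_ge0 ?(ltW C_gt0)// fsum_ge0// => z _; exact: pi_ge0.
  pose t := (3 * s * k.+1)%N.
  have t0 : (0 < t)%N by rewrite /t; move: s0; clear; nia.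
  have ex : exists i, (i <= m)%N && `[< ~ bal (Gam K) x t.-1 (p i) >].
    exists m; rewrite leqnn; apply/asboolP => h; apply: nxy; rewrite -pm.
    by apply: bal_le h; rewrite /t; move: kN; clear; nia.
  case: (ex_minnP ex) => i /andP[im /asboolP ni] imin.
  case: i im ni imin => [|i] im ni imin.
    by exfalso; apply: ni; rewrite p0; exact: bal_refl.
  have xi : bal (Gam K) x t.-1 (p i).
    apply: contrapT => h; have := imin i; rewrite ltnn => e; apply: notF; apply: e.
    by rewrite (ltnW im)/=; exact/asboolP.
  have [Gi _] := pS i (ltnW im); have [Gi1 xq] := pS i.+1 im.
  have xi1 : bal (Gam K) x t (p i.+1).
    by rewrite -(prednK t0) -addn1; apply: bal_cat xi _; apply: bal_adj => //; exact: pa.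
  have := IH (ltnW kN); have := vq _ Gi1 xq.
  have : fsum (E k) pi + fsum (bal (Gam K) (p i.+1) s) pi <= fsum (E k.+1) pi.
    apply: fsum_disjoint => //.
    - move=> z [h1 h2]; split=> //; apply: bal_le h2; clear; nia.
    - move=> z h; split; first exact: bal_cat xq (bal_subT h).
      exact: bal_cat xi1 h.
    - move=> z [_ h1] /(bal_sym adjC) h2; apply: ni.
      by apply: bal_le (bal_cat h1 h2); rewrite /t; move: s0; clear; nia.
    - by move=> z _; exact: pi_ge0.
  rewrite -/(vG _ _) -(ler_pM2l C_gt0) mulrDr -natr1 mulrDl mul1r; lra.
have := HE N0 (leqnn _).
have : fsum (E N0) pi <= v x (s + s).
  by apply: fsum_sub; [exact: finite_ball|exact: subIsetl|move=> *; exact: pi_ge0].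
rewrite -(ler_pM2l C_gt0) => h1 h2; have := le_trans h2 h1.
by rewrite ler_pM2r ?v_gt0// leNgt truncnS_gt.
Qed.

Lemma sq_mul M n : (sq (M * n) <= M * (sq n).+1)%N.
Proof.
rewrite leqNgt; apply/negP; rewrite sqP => h; have h2 := sq_lt n.
move: h h2; move: (sq n).+1 => s; clear => h h2.
have h3 : (M * n <= M * (s * s))%N by rewrite leq_mul2l (ltnW h2) orbT.
by move: h h3; case: M => [|M]; clear; nia.
Qed.

Lemma doubling_sq M : exists C, 0 < C /\ forall x n, v x (sq (M * n)) <= C * v x (sq n).
Proof.
have [C [C_gt0 HC]] := doubling M; exists C; split=> // x n.
by apply: le_trans (HC x (sq n)); apply: v_le; exact: sq_mul.
Qed.

Lemma heat_tail : exists C c, [/\ 0 < C, 0 < c & forall x n m s, (0 < n)%N -> (m <= n)%N ->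
  Pn m (ind (~` bal setT x s)) x <= C * expR (- (s%:R ^+ 2) / (c * n%:R))].
Proof.
pose T := (Num.truncn (2 * c4 / c2)).+1.
have HT : 2 * c4 <= c2 * T%:R by rewrite (mulrC c2) -ler_pdivrMr// ltW// truncnS_gt.
have [D [D_gt0 HD]] := doubling_sq T.
exists (c3 * D / c1), (2 * c4); split; rewrite ?divr_gt0 ?mulr_gt0// => x n m s n0 mn.
set F := expR _; have F_gt0 : 0 < F by exact: expR_gt0.
have Cp : 0 < c3 * D / c1 by rewrite divr_gt0// mulr_gt0.
case: m mn => [|m] mn.
  rewrite /Pn/= indF; first by rewrite mulr_ge0 ?(ltW Cp) ?(ltW F_gt0).
  by move=> h; apply: h; exact: bal_refl.
pose A := bal setT x m.+1 `&` ~` bal setT x s.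
have fA : finite_set A by apply: sub_finite_set (finite_ball setT x m.+1); exact: subIsetl.
rewrite (Pn_fsum fA); last first.
  by move=> y xy nA; apply: indF => nxs; apply: nA.
apply: (@le_trans _ _ (fsum A (fun y => c3 * D / c1 * F * kpow (T * m.+1) x y))); last first.
  by rewrite fsumZ ler_piMr ?kpow_sum_le1// mulr_ge0 ?(ltW Cp) ?(ltW F_gt0).
apply: fsum_le => // y [xy nxs]; rewrite indT// mulr1.
have [k w] := conn x y; have [wg gmin] := gdP w.
set d := gd adj setT x y in wg gmin.
have sd : (s <= d)%N.
  by rewrite leqNgt; apply/negP => ds; apply: nxs; apply/(gd_bal _ w); exact: ltnW.
have dm : (d <= m.+1)%N by apply/(gd_bal _ w).
pose E := expR (- (d%:R ^+ 2) / (2 * c4 * m.+1%:R)).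
have E_gt0 : 0 < E by exact: expR_gt0.
have EF : E <= F.
  rewrite ler_expR !mulNr lerN2; apply: ler_pM.
  - exact: sqr_ge0.
  - by rewrite invr_ge0 !mulr_ge0// ltW.
  - by rewrite ler_pXn2r ?nnegrE// ler_nat.
  - by rewrite lef_pV2 ?posrE ?mulr_gt0 ?ltr0n// ler_pM2l ?mulr_gt0// ler_nat.
have up := HK_upper m.+1 gmin.
have EE : expR (- d%:R ^+ 2 / (c4 * m.+1%:R)) = E * E.
  rewrite /E -expRD; congr expR; rewrite -mulrA invfM; field.
  by rewrite gt_eqF ?ltr0n//= gt_eqF.
have lo := @HK_lower (T * m.+1) x y d.
have {}lo := lo (ex_intro _ d (conj (leqnn d) wg)) (leq_trans dm (leq_pmull _ (ltn0Sn _))).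
have E1 : E <= expR (- d%:R ^+ 2 / (c2 * (T * m.+1)%:R)).
  rewrite ler_expR !mulNr lerN2 ler_wpM2l ?sqr_ge0//.
  rewrite lef_pV2 ?posrE ?mulr_gt0 ?ltr0n ?muln_gt0// natrM mulrA ler_pM2r ?ltr0n//.
have vm := v_gt0 x (sq m.+1); have vT := v_gt0 x (sq (T * m.+1)).
have {}lo : c1 / (D * v x (sq m.+1)) * E * pi y <= kpow (T * m.+1) x y.
  apply: le_trans lo; rewrite ler_pM2r ?pi_gt0//; apply: ler_pM => //.
  - by rewrite divr_ge0 ?mulr_ge0// ltW.
  - exact: ltW.
  - by rewrite ler_pM2l// lef_pV2 ?posrE ?mulr_gt0//; exact: HD.
apply: (le_trans up); rewrite EE.
apply: (@le_trans _ _ (c3 / v x (sq m.+1) * (E * F) * pi y)).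
  by rewrite ler_pM2r ?pi_gt0// ler_pM2l ?divr_gt0// ler_pM2l.
have -> : c3 / v x (sq m.+1) * (E * F) * pi y =
    c3 * D / c1 * F * (c1 / (D * v x (sq m.+1)) * E * pi y).
  by field; rewrite !gt_eqF.
by rewrite ler_pM2l// mulr_gt0.
Qed.

Lemma kpow_offdiag : exists C, 0 < C /\ forall n x y, (0 < gd adj setT x y)%N ->
  kpow n x y <= C / v x (gd adj setT x y) * pi y.
Proof.
pose T := (Num.truncn (c4 / c2)).+1.
have HT : c4 <= c2 * T%:R by rewrite (mulrC c2) -ler_pdivrMr// ltW// truncnS_gt.
have [D [D_gt0 HD]] := doubling_sq T.
exists (c3 * D / c1); rewrite divr_gt0 ?mulr_gt0//; split=> // n x y.
have [k w] := conn x y; have [wg gmin] := gdP w.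
set d := gd adj setT x y in wg gmin *; move=> d0.
have Cp : 0 < c3 * D / c1 by rewrite divr_gt0// mulr_gt0.
have vd := v_gt0 x d.
case: (leqP d n) => dn; last first.
  rewrite kpow_out; first by rewrite mulr_ge0 ?pi_ge0// divr_ge0 ?(ltW Cp) ?(ltW vd).
  by move=> /(gd_bal _ w); rewrite leqNgt dn.
have n0 : (0 < n)%N by exact: leq_trans dn.
pose E := expR (- (d%:R ^+ 2) / (c4 * n%:R)).
have E_gt0 : 0 < E by exact: expR_gt0.
have E1 : E <= expR (- d%:R ^+ 2 / (c2 * (T * n)%:R)).
  rewrite ler_expR !mulNr lerN2 ler_wpM2l ?sqr_ge0//.
  by rewrite lef_pV2 ?posrE ?mulr_gt0 ?ltr0n ?muln_gt0// natrM mulrA ler_pM2r ?ltr0n.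
have vn := v_gt0 x (sq n); have vT := v_gt0 x (sq (T * n)).
have h : fsum (bal setT x d) (fun z => c1 / (D * v x (sq n)) * E * pi z) <=
         fsum (bal setT x d) (kpow (T * n) x).
  apply: fsum_le => [|z xz]; first exact: finite_ball.
  apply: le_trans (HK_lower xz _); last by exact: (leq_trans dn (leq_pmull _ (ltn0Sn _))).
  rewrite ler_pM2r ?pi_gt0//; apply: ler_pM => //.
  - by rewrite divr_ge0 ?mulr_ge0// ltW.
  - exact: ltW.
  - by rewrite ler_pM2l// lef_pV2 ?posrE ?mulr_gt0//; exact: HD.
have := le_trans h (kpow_sum_le1 _ _ (finite_ball _ _ _)).
rewrite fsumZ -/(v x d) => {}h.
apply: (le_trans (HK_upper n gmin)); rewrite -/E ler_pM2r ?pi_gt0//.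
rewrite ler_pdivlMr//.
have -> : c3 / v x (sq n) * E * v x d = c3 * D / c1 * (c1 / (D * v x (sq n)) * E * v x d).
  by field; rewrite !gt_eqF.
by rewrite ler_piMr// ltW.
Qed.

Lemma series_lower x r : Gam K x -> (0 < r)%N ->
  (r * r)%:R * (vI x r / v x (2 * r)) <=
  \sum_(n < 2 * (r * r)) invW adj pi K x (Num.sqrt n%:R).
Proof.
move=> Gx r0; have -> : (2 * (r * r) = r * r + r * r)%N by rewrite mul2n addnn.
rewrite big_split_ord/=.
apply: (@le_trans _ _ (\sum_(i < r * r) vI x r / v x (2 * r))).
  by rewrite sumr_const card_ord mulr_natl.
rewrite -[leLHS]add0r; apply: lerD; first by apply: sumr_ge0 => n _; exact: invW_ge0.
apply: ler_sum => i _; rewrite invW_v; apply: ler_pM.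
- exact: vI_ge0.
- by rewrite invr_ge0 ltW// v_gt0.
- by apply: vI_le; rewrite sqP leq_addr.
- rewrite lef_pV2 ?posrE ?v_gt0 ?vG_gt0//; apply: (le_trans (vG_le_v _ _)); apply: v_le.
  rewrite leqNgt; apply/negP; rewrite sqP; have := ltn_ord i; move: (nat_of_ord i) => j.
  by clear; nia.
Qed.

Lemma Pn_indC n A x : Pn n (ind (~` A)) x = 1 - Pn n (ind A) x.
Proof.
rewrite -(Pn_cst n 1 x) -mulN1r -PnZ -PnD; apply: Pn_ext => y _; rewrite mulN1r.
case: (pselect (A y)) => yA; first by rewrite indF// indT// subrr.
by rewrite indT// indF// subr0.
Qed.

(* A walk leaving [S] from outside [T] lands outside the ball of radius [2 s], from where it is
   outside the ball of radius [s] at time [m] with probability at least 1/2. *)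
Lemma exit_bound x s n (S A T : set V) :
    (forall z w, S z -> ~ T z -> nb z w -> S w \/ ~ bal setT x (s + s) w) ->
    (forall z, S z -> ~ A z) ->
    (forall z m, (m <= n)%N -> Pn m (ind (~` bal setT z s)) z <= 2^-1) ->
  forall m z, (m <= n)%N -> S z ->
  Pn m (ind A) z <= 2 * Pn m (ind (~` bal setT x s)) z + \sum_(i < m) Pn i (ind T) z.
Proof.
move=> HS SA tail; elim=> [|m IH] z mn Sz.
  by rewrite big_ord0 addr0 /Pn/= (indF (SA z Sz)) mulr_ge0// ind_ge0.
have P0 k B w : 0 <= Pn k (ind B) w by apply: Pn_ge0; exact: ind_ge0.
have e : \sum_(i < m.+1) Pn i (ind T) z =
    ind T z + Pop (fun w => \sum_(i < m) Pn i (ind T) w) z.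
  by rewrite big_ord_recl Pop_sum.
have S0 w : 0 <= \sum_(i < m) Pn i (ind T) w by apply: sumr_ge0 => i _; exact: P0.
case: (pselect (T z)) => Tz.
  rewrite e indT//; apply: (@le_trans _ _ 1); first by apply: Pn_le1; exact: ind_le1.
  by rewrite addrCA lerDl addr_ge0// ?mulr_ge0// Pop_ge0.
rewrite e (indF Tz) add0r !PnS -PopZ -PopD; apply: Pop_le => w zw.
have [Sw|nw] := HS z w Sz Tz zw; first exact: IH (ltnW mn) Sw.
apply: (@le_trans _ _ 1); first by apply: Pn_le1; exact: ind_le1.
rewrite -[leLHS]addr0; apply: lerD => //.
have h : Pn m (ind (bal setT w s)) w <= Pn m (ind (~` bal setT x s)) w.
  apply: Pn_le => u _; apply: ind_le => wu xu; apply: nw.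
  exact: bal_cat xu (bal_sym adjC wu).
have := tail w m (ltnW mn); rewrite Pn_indC; lra.
Qed.

Lemma heat_tail_small (theta : R) : 0 < theta -> exists A, (0 < A)%N /\
  forall z r m, (0 < r)%N -> (m <= 9 * (r * r))%N ->
  Pn m (ind (~` bal setT z (A * r))) z <= theta.
Proof.
move=> t0; have [C [c [C_gt0 c_gt0 H]]] := heat_tail.
pose A := (Num.truncn (9 * c * C / theta)).+1; exists A; split=> // z r m r0 mr.
have n0 : (0 < 9 * (r * r))%N by rewrite !muln_gt0 r0.
apply: (le_trans (H _ _ _ _ n0 mr)).
have -> : - ((A * r)%:R ^+ 2) / (c * (9 * (r * r))%:R) = - (A%:R ^+ 2 / (9 * c)) :> R.
  rewrite !natrM; have : (r%:R : R) != 0 by rewrite pnatr_eq0 -lt0n.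
  by move: (r%:R : R) (A%:R : R) => a b a0; field; rewrite a0 gt_eqF.
rewrite expRN -ler_pdivlMr ?invr_gt0 ?expR_gt0// invrK.
rewrite mulrC -ler_pdivrMr//.
have h : 9 * c * C / theta < A%:R by exact: truncnS_gt.
have A1 : 1 <= (A%:R : R) by rewrite ler1n.
apply: le_trans (expR_ge1Dx _); rewrite -[leLHS]add0r; apply: lerD => //.
rewrite ler_pdivlMr ?mulr_gt0//.
have -> : C / theta * (9 * c) = 9 * c * C / theta by ring.
by apply: (le_trans (ltW h)); rewrite expr2 ler_peMl// (le_trans ler01).
Qed.

Lemma hit_lower : exists c, 0 < c /\ forall x y x' r, Gam K y -> (0 < r)%N ->
  bal setT x r y -> bal setT x r x' ->
  c <= Pn (9 * (r * r)) (ind (bal (Gam K) y r)) x'.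
Proof.
have [C1 [C1_gt0 HC1]] := vG_large; have [C2 [C2_gt0 HC2]] := doubling 5.
exists (c1 * expR (- c2^-1) / (C2 * C1)).
rewrite divr_gt0 ?mulr_gt0 ?expR_gt0//; split=> // x y x' r Gy r0 xy xx'.
have fB := finite_ball (Gam K) y r.
apply: le_trans (Pn_fsum_ge _ x' fB (ind_ge0 _)).
have sqn : sq (9 * (r * r)) = (3 * r)%N by apply: sq_eq; clear; nia.
have V0 := v_gt0 x' (3 * r).
apply: (@le_trans _ _ (fsum (bal (Gam K) y r)
    (fun w => c1 / v x' (3 * r) * expR (- c2^-1) * pi w))); last first.
  apply: fsum_le => // w yw; rewrite indT// mulr1.
  have xw : bal setT x' (3 * r) w.
    have -> : (3 * r = r + r + r)%N by clear; lia.
    by apply: bal_cat (bal_subT yw); apply: bal_cat xy; exact: (bal_sym adjC).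
  apply: le_trans (HK_lower xw _); last by move: r0; clear; nia.
  rewrite sqn ler_pM2r ?pi_gt0// ler_pM2l ?divr_gt0// ler_expR.
  have -> : - ((3 * r)%:R ^+ 2) / (c2 * (9 * (r * r))%:R) = - c2^-1 :> R.
    rewrite !natrM; have : (r%:R : R) != 0 by rewrite pnatr_eq0 -lt0n.
    by move: (r%:R : R) => a a0; field; rewrite a0 gt_eqF.
  exact: lexx.
rewrite fsumZ -/(vG y r).
have h : v x' (3 * r) <= C2 * C1 * vG y r.
  have yx' : bal setT y (r + r) x' by apply: bal_cat xx'; exact: (bal_sym adjC).
  apply: (le_trans (v_shift (3 * r) yx')).
  apply: (@le_trans _ _ (v y (5 * r.+1))); first by apply: v_le; clear; lia.
  by apply: (le_trans (HC2 y r)); rewrite -mulrA ler_pM2l//; exact: HC1.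
have e0 := expR_gt0 (- c2^-1).
rewrite ler_pdivrMr ?mulr_gt0//.
have -> : c1 / v x' (3 * r) * expR (- c2^-1) * vG y r * (C2 * C1) =
   c1 * expR (- c2^-1) * ((C2 * C1 * vG y r) / v x' (3 * r)) by ring.
by rewrite ler_peMr ?mulr_ge0 ?(ltW c1_gt0) ?(ltW e0)// ler_pdivlMr// mul1r.
Qed.

Lemma inner_dist_comparable : exists A e0, [/\ (0 < A)%N, 0 < e0 &
  forall x y, Gam K x -> Gam K y ->
  (forall N, \sum_(n < N) invW adj pi K x (Num.sqrt n%:R) <= e0) ->
  bal (Gam K) x (A * gd adj setT x y) y].
Proof.
have [c0 [c0_gt0 Hc0]] := hit_lower.
have [N [N0 HN]] := inner_diameter.
pose theta := Num.min 2^-1 (c0 / 4).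
have theta_gt0 : 0 < theta by rewrite lt_min invr_gt0 ltr0n divr_gt0.
have theta2 : theta <= 2^-1 by rewrite ge_min lexx.
have thetac : theta <= c0 / 4 by rewrite ge_min lexx orbT.
have [A [A0 HA]] := heat_tail_small theta_gt0.
pose Q := (N * (2 * A.+1))%N; have Q0 : (0 < Q)%N by rewrite !muln_gt0 N0.
have [C1 [C1_gt0 HC1]] := vG_large; have [D [D_gt0 HD]] := doubling (2 * Q).
exists Q.+1, (c0 / (36 * (D * C1))); split=> //.
  by rewrite divr_gt0// mulr_gt0// mulr_gt0.
move=> x y Gx Gy Hser; set r := gd adj setT x y.
have [k w] := conn x y; have [wg _] := gdP w; rewrite -/r in wg.
case: (posnP r) => [r0|r0].
  by rewrite r0 muln0; move: wg; rewrite r0 => /walk_inv0 <-; exact: bal_refl.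
have xy : bal setT x r y by exists r.
apply: contrapT => nxy.
pose s := (A.+1 * r)%N; pose n := (9 * (r * r))%N.
have s0 : (0 < s)%N by rewrite muln_gt0 r0.
pose S := [set z | exists m, walk (Gam K `&` bal setT x (s + s)) x z m].
have SQ z : S z -> bal (Gam K) x (Q * r) z.
  move=> [m wz]; have := HN x (s + s)%N z m; rewrite addn_gt0 s0 => /(_ isT wz).
  by apply: bal_le; rewrite /Q /s; clear; nia.
pose T := bdryI adj K `&` S.
have B1S z : bal (Gam K) x r z -> S z.
  move=> [m [mr [p [p0 pm pS pa]]]]; exists m; exists p; split=> // j jm; split; first exact: pS.
  exists j; split; first by move: jm mr; rewrite /s; clear; nia.
  by rewrite -p0; exact: (walk_subT (walk_prefix jm pS pa)).
have SA z : S z -> ~ bal (Gam K) y r z.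
  move=> /SQ xz /(bal_sym adjC) zy; apply: nxy.
  by rewrite mulSn addnC; exact: bal_cat xz zy.
have HS z u : S z -> ~ T z -> nb z u -> S u \/ ~ bal setT x (s + s) u.
  move=> Sz nT [->|zu]; first by left.
  case: (pselect (bal setT x (s + s) u)) => xu; [left|by right].
  have [m wz] := Sz; have [Gz xz] := walk_endP wz.
  have Gu : Gam K u.
    apply/negP => Ku; apply: nT; split=> //; split=> //; by exists u.
  exists (m + 1)%N; apply: walk_cat wz _; exact: walk_adj.
have tail1 z m : (m <= n)%N -> Pn m (ind (~` bal setT z s)) z <= 2^-1.
  move=> mn; apply: le_trans theta2; apply: le_trans (HA z r m r0 mn).
  apply: Pn_le => u _; apply: ind_le => /= nzu zu; apply: nzu.
  by apply: bal_le zu; rewrite /s; clear; nia.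
have key := exit_bound HS SA tail1.
have fB := finite_ball (Gam K) x r.
have fT : finite_set T.
  by apply: sub_finite_set (finite_ball (Gam K) x (Q * r)) => z [_ /SQ].
have key1 x' : bal (Gam K) x r x' -> c0 / 2 <= \sum_(i < n) Pn i (ind T) x'.
  move=> xx'; have := key n x' (leqnn n) (B1S _ xx').
  have := Hc0 x y x' r Gy r0 xy (bal_subT xx'); rewrite -/n.
  have : Pn n (ind (~` bal setT x s)) x' <= theta.
    apply: le_trans (HA x' r n r0 (leqnn _)).
    apply: Pn_le => u _; apply: ind_le => /= nxu x'u; apply: nxu.
    by rewrite /s mulSn; exact: bal_cat (bal_subT xx') x'u.
  lra.
have h1 : c0 / 2 * vG x r <= n%:R * vI x (Q * r).
  rewrite /vG -fsumZ.
  apply: (@le_trans _ _ (fsum (bal (Gam K) x r)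
      (fun x' => \sum_(i < n) pi x' * Pn i (ind T) x'))).
    apply: fsum_le => // x' xx'; rewrite -mulr_sumr mulrC ler_pM2l ?pi_gt0//; exact: key1.
  rewrite /fsum exchange_big/=; apply: (@le_trans _ _ (\sum_(i < n) fsum T pi)).
    by apply: ler_sum => i _; exact: Pn_pi_le.
  rewrite sumr_const card_ord -[leLHS]mulr_natl ler_wpM2l//; apply: fsum_sub.
  - exact: finite_ballI.
  - by move=> z [Iz Sz]; split=> //; exact: SQ.
  - by move=> *; exact: pi_ge0.
have Qr0 : (0 < Q * r)%N by rewrite muln_gt0 Q0.
have := series_lower Gx Qr0.
have := Hser (2 * (Q * r * (Q * r)))%N; move: (\sum_(_ < _) _) => Sg.
have vQ : v x (2 * (Q * r)) <= D * C1 * vG x r.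
  apply: (@le_trans _ _ (v x (2 * Q * r.+1))); first by apply: v_le; clear; nia.
  by apply: (le_trans (HD x r)); rewrite -mulrA ler_pM2l//; exact: HC1.
have g0 := vG_gt0 r Gx; have v20 := v_gt0 x (2 * (Q * r)).
have I0 := vI_ge0 x (Q * r).
move=> hs1 hs2; have {hs1 hs2} := le_trans hs2 hs1; apply/negP; rewrite -ltNge.
apply: (@lt_le_trans _ _ ((r * r)%:R * (vI x (Q * r) / (D * C1 * vG x r)))).
  rewrite [ltRHS]mulrA ltr_pdivlMr ?mulr_gt0//.
  have -> : c0 / (36 * (D * C1)) * (D * C1 * vG x r) = c0 / 36 * vG x r.
    by field; rewrite !gt_eqF.
  move: h1; rewrite /n natrM; move: (vI _ _) (vG _ _) g0 ((r * r)%:R : R) => a b b0 cc.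
  have := mulr_gt0 c0_gt0 b0; lra.
apply: ler_pM => //.
- by rewrite mulr_ge0// invr_ge0 !mulr_ge0// ltW.
- by rewrite ler_nat leq_mul// leq_pmull.
- by rewrite ler_wpM2l// lef_pV2 ?posrE ?mulr_gt0.
Qed.

Lemma kpow_series M : (0 < M)%N -> exists C, 0 < C /\ forall x y N N',
  (0 < gd adj setT x y)%N -> (N <= N')%N ->
  (M.+1 * (gd adj setT x y * gd adj setT x y) <= N')%N ->
  \sum_(n < N) kpow n x y <= C * pi y *
    \sum_(n < N' | (M * (gd adj setT x y * gd adj setT x y) <= n)%N) (v x (sq n))^-1.
Proof.
move=> M0; have [C1 [C1_gt0 HC1]] := kpow_offdiag.
have [D [D_gt0 HD]] := doubling M.+1.
pose C := C1 + c3; have C_gt0 : 0 < C by rewrite addr_gt0.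
exists (C * (M%:R * D + 1)); split; first by rewrite mulr_gt0// addr_gt0 ?mulr_gt0 ?ltr0n.
move=> x y N N'; set d := gd adj setT x y => d0 NN' dN'.
pose a := (M * (d * d))%N; pose g n := (v x (sq n))^-1.
have g0 n : 0 <= g n by rewrite invr_ge0 ltW// v_gt0.
have vd := v_gt0 x d; have py := pi_gt0 y.
pose Sg := \sum_(n < N' | (a <= n)%N) g n.
rewrite -/(Sg).
have aN' : (a <= N')%N by apply: leq_trans dN'; rewrite leq_mul2r leqnSn orbT.
have h1 : \sum_(n < N) kpow n x y <=
    C * pi y * (\sum_(n < N | (n < a)%N) (v x d)^-1 + \sum_(n < N | ~~ (n < a)%N) g n).
  rewrite mulrDr !mulr_sumr (bigID (fun n : 'I_N => (n < a)%N))/=; apply: lerD.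
    apply: ler_sum => n _; apply: (le_trans (HC1 n x y d0)).
    by rewrite -/d [leRHS]mulrAC ler_pM2r// ler_pM2r ?invr_gt0// lerDl ltW.
  apply: ler_sum => n _; apply: (le_trans (@HK_upper n x y 0 _)) => //.
  rewrite expr0n/= oppr0 mul0r expR0 mulr1 [leRHS]mulrAC ler_pM2r//.
  by apply: ler_wpM2r; [exact: g0|rewrite lerDr ltW].
have h2 : \sum_(n < N | ~~ (n < a)%N) g n <= Sg.
  rewrite /Sg; under eq_bigl do rewrite -leqNgt.
  rewrite (big_ord_widen_cond N' (fun n => (a <= n)%N) g NN').
  rewrite big_mkcond [leRHS]big_mkcond; apply: ler_sum => n _.
  by case: (a <= n)%N => //=; case: ifP.
have h3 : \sum_(n < N | (n < a)%N) (v x d)^-1 <= a%:R * (v x d)^-1.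
  apply: (@le_trans _ _ (\sum_(n < a) (v x d)^-1)); last first.
    by rewrite sumr_const card_ord mulr_natl.
  rewrite -(big_mkord (fun n => (n < a)%N) (fun=> (v x d)^-1)).
  rewrite -(big_mkord xpredT (fun=> (v x d)^-1)).
  case: (leqP a N) => aN; last first.
    rewrite (big_cat_nat (leq0n N) (ltnW aN))/=.
    rewrite [leLHS]big_mkcond/=; apply: ler_wpDr.
      by apply: sumr_ge0 => *; rewrite invr_ge0 ltW.
    by apply: ler_sum => n _; case: ifP => // _; rewrite invr_ge0 ltW.
  rewrite (big_cat_nat (leq0n a) aN)/= [X in _ + X]big_nat_cond [X in _ + X]big1; last first.
    by move=> n /andP[/andP[an _]]; rewrite ltnNge an.
  rewrite addr0 big_mkcond; apply: ler_sum => n _; case: ifP => // _.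
  by rewrite invr_ge0 ltW.
have h4 : (d * d)%:R * (D * v x d)^-1 <= Sg.
  apply: (@le_trans _ _ (\sum_(a <= n < M.+1 * (d * d)) (D * v x d)^-1)).
    by rewrite sumr_const_nat mulr_natl /a mulSn addnK.
  rewrite /Sg -(big_mkord (fun n => (a <= n)%N) g) (big_cat_nat (leq0n a) aN')/=.
  apply: ler_wpDl; first by apply: sumr_ge0.
  have aM : (a <= M.+1 * (d * d))%N by rewrite leq_mul2r leqnSn orbT.
  rewrite (big_cat_nat aM dN')/=; apply: ler_wpDr; first by apply: sumr_ge0.
  rewrite [leRHS]big_mkcond big_nat [leRHS]big_nat; apply: ler_sum => n /andP[an nM].
  rewrite an lef_pV2 ?posrE ?mulr_gt0 ?v_gt0//.
  apply: le_trans (HD x d); apply: v_le; rewrite leqNgt; apply/negP; rewrite sqP.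
  by move: nM; clear; nia.
apply: (le_trans h1); rewrite [C * (_ + _)]mulrC -!mulrA [leRHS]mulrCA ler_pM2l//.
rewrite mulrCA ler_pM2l// mulrDl mul1r; apply: lerD => //; apply: (le_trans h3).
rewrite /a natrM -mulrA -mulrA ler_wpM2l//.
have := ler_wpM2l (ltW D_gt0) h4; apply: le_trans.
by rewrite invfM mulrCA mulVKf// gt_eqF.
Qed.

Lemma hitn_le_green N x : ~~ K x -> hitn N x <= green N x.
Proof.
elim: N x => [|N IH] x Kx; first by rewrite green0 /= (negbTE Kx).
rewrite greenS hitnS (negbTE Kx).
have g0 z : 0 <= green N z.
  by apply: sumr_ge0 => n _; apply: Pn_ge0; exact: ind_ge0.
case: (pselect (dI x)) => Ix.
  rewrite indT//; apply: (@le_trans _ _ 1); last by rewrite lerDl Pop_ge0.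
  rewrite -[leRHS](Pop_cst 1 x); apply: Pop_le => z _.
  by case/andP: (hitn_ge0_le1 N z).
rewrite indF// add0r; apply: Pop_le => z xz; apply: IH; apply/negP => Kz.
apply: Ix; split=> //; exists z; split=> //.
by case: xz => // zx; move: Kz; rewrite zx (negbTE Kx).
Qed.

Lemma green_series : exists C e0, [/\ 0 < C, 0 < e0 &
  forall x, Gam K x -> ~ dI x ->
  (forall N, \sum_(n < N) invW adj pi K x (Num.sqrt n%:R) <= e0) ->
  forall N, exists N', green N x <= C * \sum_(n < N') invW adj pi K x (Num.sqrt n%:R)].
Proof.
have [A [e0 [A0 e0_gt0 HA]]] := inner_dist_comparable.
have [|C [C_gt0 HC]] := @kpow_series (A * A); first by rewrite muln_gt0 A0.
exists C, e0; split=> // x Gx nIx Hser N.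
pose F := dI `&` bal setT x N.
have fF : finite_set F by apply: sub_finite_set (finite_ball setT x N); exact: subIsetr.
pose N' := (N + (A * A).+1 * (N * N))%N; exists N'.
have e1 : green N x = fsum F (fun y => \sum_(n < N) kpow n x y).
  rewrite /fsum exchange_big; apply: eq_bigr => n _; rewrite (Pn_fsum fF).
    by apply: fsum_ext => // y [Iy _]; rewrite indT// mulr1.
  move=> y xy nF; apply: indF => Iy; apply: nF; split=> //; apply: bal_le xy.
  exact: ltnW.
rewrite e1.
apply: (@le_trans _ _ (fsum F (fun y => C * \sum_(n < N')
    (if y \in bal (Gam K) x (sq n) then pi y else 0) * (v x (sq n))^-1))).
  apply: fsum_le => // y [Iy xy]; have [k w] := conn x y.
  have d0 : (0 < gd adj setT x y)%N.
    have [wg _] := gdP w; rewrite lt0n; apply/eqP => d0; apply: nIx.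
    by move: wg; rewrite d0 => /walk_inv0 ->.
  have dN : (gd adj setT x y <= N)%N by apply/(gd_bal _ w).
  apply: (le_trans (HC x y N N' d0 _ _)); [by rewrite leq_addr| |].
    by apply: leq_trans (leq_addl _ _); rewrite leq_mul2l leq_mul// orbT.
  rewrite -mulrA ler_pM2l// mulr_sumr big_mkcond; apply: ler_sum => n _.
  have v0' : 0 <= (v x (sq n))^-1 by rewrite invr_ge0 ltW// v_gt0.
  case: ifP => an; last by rewrite mulr_ge0//; case: ifP => // _; exact: pi_ge0.
  rewrite mem_set//; apply: bal_le (HA x y Gx (proj1 Iy) Hser).
  by rewrite sqP mulnACA.
rewrite fsumZ ler_pM2l// /fsum exchange_big/=; apply: ler_sum => n _.
rewrite -mulr_suml -/(fsum F _) invW_v; apply: ler_pM.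
- by apply: fsum_ge0 => // y _; case: ifP => // _; exact: pi_ge0.
- by rewrite invr_ge0 ltW// v_gt0.
- apply: (@le_trans _ _ (fsum (F `&` bal (Gam K) x (sq n)) pi)).
    rewrite [leRHS](@fsum_mkcond _ _ _ F)//.
    apply: fsum_le => // y Fy; case: ifPn => [|_].
      by rewrite inE => xy; rewrite mem_set.
    by case: ifP => // _; exact: pi_ge0.
  apply: fsum_sub; [exact: finite_ballI| |by move=> *; exact: pi_ge0].
  by move=> y [[Iy _] xy]; split.
- by rewrite lef_pV2 ?posrE ?v_gt0 ?vG_gt0//; exact: vG_le_v.
Qed.

Lemma series_transient :
  (forall eps : R, 0 < eps -> exists Leps : R, 0 < Leps /\
       forall x, Gam K x -> (Leps%:E <= dist_set R adj setT x K)%E ->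
         (bdry_series adj pi K x <= eps%:E)%E) ->
  uniformly_S_transient adj mu pi K.
Proof.
have [C [e0 [C_gt0 e0_gt0 H]]] := green_series; move=> Hs.
pose e := Num.min e0 (2 * C)^-1.
have e_gt0 : 0 < e by rewrite lt_min e0_gt0 invr_gt0 mulr_gt0.
have [L [L_gt0 HL]] := Hs e e_gt0.
exists (L + 2), 2^-1; split; rewrite ?invr_gt0 ?addr_gt0// => x xK.
have Gx : Gam K x.
  apply/negP => Kx; move/dist_setP: xK => /(_ x 0%N Kx (walk0 _ I)); lra.
have nIx : ~ dI x.
  move=> [_ [z [Kz xz]]]; move/dist_setP: xK => /(_ z 1%N Kz (walk_adj I I xz)); lra.
have Hx N : \sum_(n < N) invW adj pi K x (Num.sqrt n%:R) <= e.
  rewrite -lee_fin; apply: (le_trans (bdry_series_ge N Gx)); apply: HL => //.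
  by apply: le_trans xK; rewrite lee_fin lerDl.
apply: psiK_le => N; apply: (le_trans (hitn_le_green N Gx)).
have [|N' h] := H x Gx nIx _ N.
  by move=> M; apply: (le_trans (Hx M)); rewrite ge_min lexx.
apply: (le_trans h); apply: (@le_trans _ _ (C * (2 * C)^-1)).
  by rewrite ler_pM2l// (le_trans (Hx _))// ge_min lexx orbT.
by rewrite invfM mulrCA divff ?gt_eqF// mulr1; lra.
Qed.

End MarkovOperator.

Unset Implicit Arguments.

Theorem theorem3p15 (R : realType) (V : choiceType) (adj : rel V)
  (mu : V -> V -> R) (pi : V -> R) (K : pred V) :
  simple_connected_infinite adj ->
  weights_ok adj mu pi ->
  controlled_weights adj mu pi ->
  uniformly_lazy adj mu pi ->
  harnack_graph adj mu pi ->
  ~ finite_set (Gam K) ->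
  inner_uniform R adj K ->
  (uniformly_S_transient adj mu pi K ->
     exists L' eps' : R, [/\ 0 < L', 0 < eps' &
       forall x, Gam K x -> (L'%:E <= dist_set R adj setT x K)%E ->
         (bdry_series adj pi K x <= eps'%:E)%E])
  /\
  ((forall eps : R, 0 < eps -> exists Leps : R, 0 < Leps /\
       forall x, Gam K x -> (Leps%:E <= dist_set R adj setT x K)%E ->
         (bdry_series adj pi K x <= eps%:E)%E) ->
   uniformly_S_transient adj mu pi K).
Proof.
move=> Hg Hw [Cc [Cc_gt0 HCc]] [Ce [Ce_gt0 HCe]].
move=> [c1 [c2 [c3 [c4 [c1_gt0 c2_gt0 c3_gt0 c4_gt0 HK]]]]].
move=> Ginf [cu [CU [cu_gt0 _ HIU]]]; split.
  exact: (transient_series Hg Hw Cc_gt0 HCc c1_gt0 c2_gt0 c3_gt0 c4_gt0 HK Ce_gt0 HCe cu_gt0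
    Ginf HIU).
exact: (series_transient Hg Hw Cc_gt0 HCc c1_gt0 c2_gt0 c3_gt0 c4_gt0 HK Ce_gt0 HCe cu_gt0
  Ginf HIU).
Qed.
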